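(* Let $A,B$ be bounded double complexes over a field $K$. - There exists an $E_1$-isomorphism $A\to B$ if and only if $\operatorname{mult}_S(A)=\operatorname{mult}_S(B)$ for all zigzag shapes $S$. - An $E_1$-isomorphism $A\to B$ also induces an isomorphism in Bott-Chern cohomology $H_{BC}$ and Aeppli cohomology $H_A$, and more generally under any linear functor from bounded double complexes over $K$ to $K$-vector spaces that maps squares to $0$.
   Context: A double complex over a field $K$ is a bigraded $K$-vector space $A=\bigoplus_{p,q\in\mathbb{Z}}A^{p,q}$ with endomorphisms $\partial_1,\partial_2$ of bidegree $(1,0)$ and $(0,1)$ satisfying $\partial_1^2=\partial_2^2=0$ and $\partial_1\partial_2+\partial_2\partial_1=0$. It is bounded if $A^{p,q}=0$ for all but finitely many $(p,q)$. Morphisms respect bigrading and $\partial_1,\partial_2$. A shape is one of the following finite subsets of $\mathbb{Z}^2$. - Square shapes: $S^{p,q}=\{(p,q),(p-1,q),(p,q-1),(p-1,q-1)\}$. - Even zigzag shapes ($r\ge 1$): $S_{1,r}^{p,q}=\{(p+j,q-j),(p+j+1,q-j)\mid 0\le j\le r-1\}$ and $S_{2,r}^{p,q}=\{(p-j,q+j),(p-j,q+j+1)\mid 0\le j\le r-1\}$. - Odd zigzag shapes: if $p+q\le d$, $S_d^{p,q}=\{(j,d-j)\mid p\le j\le d-q\}\cup\{(j,d+1-j)\mid p+1\le j\le d-q\}$; if $p+q> d$, $S_d^{p,q}=\{(j,d-j)\mid d-q\le j\le p\}\cup\{(j,d-1-j)\mid d-q\le j\le p-1\}$. For a shape $S$,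 $C(S)$ is the (unique up to isomorphism) double complex that is one-dimensional in the bidegrees of $S$, zero elsewhere, with every component of $\partial_1,\partial_2$ between two bidegrees of $S$ an isomorphism; it is called a square or zigzag accordingly. Every bounded double complex $A$ is isomorphic to $\bigoplus_S C(S)^{\oplus\operatorname{mult}_S(A)}$ for unique cardinals $\operatorname{mult}_S(A)$. A morphism $A\to B$ is an $E_1$-isomorphism if it induces an isomorphism on the first page of both Frölicher spectral sequences, i.e. on $H_{\partial_1}^{p,q}=H^p(A^{\cdot,q},\partial_1)$ and on $H_{\partial_2}^{p,q}=H^q(A^{p,\cdot},\partial_2)$ for all $p,q$. Further, $H_{BC}^{p,q}(A)=\left(\frac{\ker\partial_1\cap\ker\partial_2}{\operatorname{im}\partial_1\partial_2}\right)^{p,q}$ and $H_A^{p,q}(A)=\left(\frac{\ker\partial_1\partial_2}{\operatorname{im}\partial_1+\operatorname{im}\partial_2}\right)^{p,q}$ for $p,q\in\mathbb{Z}$.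
   Formalization: For general linear functors killing squares, the formal theorem also assumes that the functor kills arbitrary direct sums of copies of a square, or that A and B are finite-dimensional; without this the claim fails, e.g. for Hom(W, X^{0,0}) modulo finite-rank maps with W infinite-dimensional. *)

(* Defs.v *)
From HB Require Import structures.
From mathcomp Require Import all_boot all_order all_algebra.
From mathcomp Require Import boolp classical_sets functions cardinality.
From mathcomp Require Import zify.

Set Implicit Arguments.
Unset Strict Implicit.
Unset Printing Implicit Defensive.

Import Order.TTheory GRing.Theory Num.Theory.
Local Open Scope classical_set_scope.
Local Open Scope quotient_scope.
Local Open Scope ring_scope.

Section Submodules.
Variables (K : fieldType) (U V : lmodType K).

Definition ker_of (f : {linear U -> V}) : {pred U} := [pred x | f x == 0].

Fact ker_of_closed f : submod_closed (ker_of f).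
Proof.
split=> [|a x y]; rewrite !inE ?raddf0 // => /eqP fx /eqP fy.
by rewrite linearP fx fy scaler0 addr0.
Qed.
HB.instance Definition _ f :=
  GRing.isSubmodClosed.Build K U (ker_of f) (ker_of_closed f).

Definition im_of (f : {linear U -> V}) : {pred V} :=
  [pred y | `[< exists x, f x = y >]].

Fact im_of_closed f : submod_closed (im_of f).
Proof.
split=> [|a x y]; rewrite !inE; first by exists 0; rewrite raddf0.
move=> [x' <-] [y' <-].
by exists (a *: x' + y'); rewrite linearP.
Qed.
HB.instance Definition _ f :=
  GRing.isSubmodClosed.Build K V (im_of f) (im_of_closed f).

Definition cap_of (S T : submodClosed U) : {pred U} :=
  [pred x | (x \in S) && (x \in T)].

Fact cap_of_closed S T : submod_closed (cap_of S T).
Proof.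
split=> [|a x y]; rewrite !inE ?rpred0 // => /andP[xS xT] /andP[yS yT].
by rewrite !rpredD ?rpredZ.
Qed.
HB.instance Definition _ S T :=
  GRing.isSubmodClosed.Build K U (cap_of S T) (cap_of_closed S T).

Definition sum_of (S T : submodClosed U) : {pred U} :=
  [pred x | `[< exists s t, [/\ s \in S, t \in T & x = s + t] >]].

Fact sum_of_closed S T : submod_closed (sum_of S T).
Proof.
split=> [|a x y]; rewrite !inE.
  by exists 0, 0; rewrite !rpred0 addr0.
move=> [s [t [sS tT ->]]] [s' [t' [sS' tT' ->]]].
exists (a *: s + s'), (a *: t + t').
by rewrite !rpredD ?rpredZ // scalerDr addrACA.
Qed.
HB.instance Definition _ S T :=
  GRing.isSubmodClosed.Build K U (sum_of S T) (sum_of_closed S T).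

End Submodules.

Section Subquotient.
Variables (K : fieldType) (V : lmodType K) (Z B : submodClosed V).

Record submod := Submod { submod_val :> V; submod_valP : submod_val \in Z }.
HB.instance Definition _ := [isSub for submod_val].
HB.instance Definition _ := [Choice of submod by <:].
HB.instance Definition _ := [SubChoice_isSubLmodule of submod by <:].

Fact submod_valZ a (x : submod) : val (a *: x) = a *: val x.
Proof. by []. Qed.
Fact submod_valD (x y : submod) : val (x + y) = val x + val y.
Proof. by []. Qed.

Definition submodB : {pred submod} := [pred x | val x \in B].
Fact submodB_closed : submod_closed submodB.
Proof.
split=> [|a x y]; rewrite !inE ?raddf0 ?rpred0 //= => xB yB.
by rewrite rpredD ?rpredZ.
Qed.
HB.instance Definition _ :=
  GRing.isSubmodClosed.Build K submod submodB submodB_closed.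

(* Z / (Z :&: B); this is used below only for B contained in Z. *)
Definition subquot := Quotient.quot submodB.
HB.instance Definition _ := GRing.Zmodule.on subquot.
HB.instance Definition _ := EqQuotient.on subquot.

Definition subquot_pi (x : submod) : subquot := \pi_(Quotient.quot submodB) x.

Lemma subquot_piP x y :
  reflect (subquot_pi x = subquot_pi y) (val x - val y \in B).
Proof.
by rewrite -raddfB; apply: (iffP idP) => [h|/eqP];
  [apply/eqP|]; rewrite /subquot_pi -Quotient.idealrBE.
Qed.

Lemma subquot_piD x y : subquot_pi (x + y) = subquot_pi x + subquot_pi y.
Proof. exact: raddfD. Qed.

Lemma subquot_piK x : subquot_pi (repr x) = x.
Proof. exact: reprK. Qed.

Definition subquot_scale (a : K) (x : subquot) : subquot :=
  subquot_pi (a *: repr x).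

Lemma subquot_scaleE a x : subquot_scale a (subquot_pi x) = subquot_pi (a *: x).
Proof.
apply/subquot_piP; rewrite !submod_valZ -scalerBr rpredZ //.
by apply/subquot_piP; rewrite subquot_piK.
Qed.

Lemma subquot_ind (P : subquot -> Prop) :
  (forall x, P (subquot_pi x)) -> forall x, P x.
Proof. by move=> h x; rewrite -[x]subquot_piK. Qed.

Lemma subquot_scaleA a b x :
  subquot_scale a (subquot_scale b x) = subquot_scale (a * b) x.
Proof. by elim/subquot_ind: x => x; rewrite !subquot_scaleE scalerA. Qed.
Lemma subquot_scale1 : left_id 1 subquot_scale.
Proof. by elim/subquot_ind => x; rewrite subquot_scaleE scale1r. Qed.
Lemma subquot_scaleDr : right_distributive subquot_scale +%R.
Proof.
move=> a; elim/subquot_ind => x; elim/subquot_ind => y.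
by rewrite -subquot_piD !subquot_scaleE scalerDr subquot_piD.
Qed.
Lemma subquot_scaleDl x : {morph subquot_scale^~ x : a b / a + b}.
Proof.
elim/subquot_ind: x => x a b.
by rewrite !subquot_scaleE scalerDl subquot_piD.
Qed.
HB.instance Definition _ := GRing.Zmodule_isLmodule.Build K subquot
  subquot_scaleA subquot_scale1 subquot_scaleDr subquot_scaleDl.

End Subquotient.

Section SubquotientMap.
Variables (K : fieldType) (V W : lmodType K) (f : {linear V -> W}).
Variables (Z B : submodClosed V) (Z' B' : submodClosed W).
Hypothesis fZ : {in Z, forall x, f x \in Z'}.
Hypothesis fB : {in B, forall x, f x \in B'}.

Definition subquot_map_fun (x : subquot Z B) : subquot Z' B' :=
  subquot_pi B' (Submod (fZ (submod_valP (repr x)))).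

Lemma subquot_map_funE (x : submod Z) :
  subquot_map_fun (subquot_pi B x) = subquot_pi B' (Submod (fZ (submod_valP x))).
Proof.
apply/subquot_piP => /=; rewrite -raddfB fB //.
by apply/subquot_piP; rewrite subquot_piK.
Qed.

Lemma subquot_map_linear : linear subquot_map_fun.
Proof.
move=> a; elim/subquot_ind => x; elim/subquot_ind => y.
rewrite [a *: _]subquot_scaleE -subquot_piD !subquot_map_funE.
rewrite [a *: _ in RHS]subquot_scaleE -subquot_piD.
by congr subquot_pi; apply: val_inj => /=; rewrite linearP.
Qed.

Definition subquot_map : {linear subquot Z B -> subquot Z' B'} :=
  HB.pack subquot_map_fun
    (GRing.isLinear.Build K _ _ _ subquot_map_fun subquot_map_linear).

End SubquotientMap.

Section DirectSum.
Variables (K : fieldType) (I : Type).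

Definition dprod (V : I -> lmodType K) : Type := forall i, V i.

Section Product.
Variable V : I -> lmodType K.
HB.instance Definition _ := gen_eqMixin (dprod V).
HB.instance Definition _ := gen_choiceMixin (dprod V).

Definition dprod_zero : dprod V := fun i => 0.
Definition dprod_opp (x : dprod V) : dprod V := fun i => - x i.
Definition dprod_add (x y : dprod V) : dprod V := fun i => x i + y i.
Definition dprod_scale (a : K) (x : dprod V) : dprod V := fun i => a *: x i.

Fact dprod_addA : associative dprod_add.
Proof. by move=> x y z; apply: functional_extensionality_dep => i; apply: addrA. Qed.
Fact dprod_addC : commutative dprod_add.
Proof. by move=> x y; apply: functional_extensionality_dep => i; apply: addrC. Qed.
Fact dprod_add0 : left_id dprod_zero dprod_add.
Proof. by move=> x; apply: functional_extensionality_dep => i; apply: add0r. Qed.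
Fact dprod_addN : left_inverse dprod_zero dprod_opp dprod_add.
Proof. by move=> x; apply: functional_extensionality_dep => i; apply: addNr. Qed.
HB.instance Definition _ := GRing.isZmodule.Build (dprod V)
  dprod_addA dprod_addC dprod_add0 dprod_addN.

Fact dprod_scaleA a b x :
  dprod_scale a (dprod_scale b x) = dprod_scale (a * b) x.
Proof. by apply: functional_extensionality_dep => i; apply: scalerA. Qed.
Fact dprod_scale1 : left_id 1 dprod_scale.
Proof. by move=> x; apply: functional_extensionality_dep => i; apply: scale1r. Qed.
Fact dprod_scaleDr : right_distributive dprod_scale +%R.
Proof. by move=> a x y; apply: functional_extensionality_dep => i; apply: scalerDr. Qed.
Fact dprod_scaleDl x : {morph dprod_scale^~ x : a b / a + b}.
Proof. by move=> a b; apply: functional_extensionality_dep => i; apply: scalerDl. Qed.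
HB.instance Definition _ := GRing.Zmodule_isLmodule.Build K (dprod V)
  dprod_scaleA dprod_scale1 dprod_scaleDr dprod_scaleDl.

Definition finsupp : {pred dprod V} :=
  [pred x | `[< finite_set [set i | x i <> 0] >]].

Fact finsupp_closed : submod_closed finsupp.
Proof.
split=> [|a x y]; rewrite !inE.
  rewrite (_ : [set _ | _] = set0); first exact: finite_set0.
  by apply/seteqP; split=> i //= /(_ erefl).
move=> fx fy.
apply: (@sub_finite_set _ _ ([set i | x i <> 0] `|` [set i | y i <> 0])); last first.
  by rewrite finite_setU.
move=> i /= nz; have [xi|] := pselect (x i = 0); last by left.
right=> yi; apply: nz.
by rewrite -[LHS]/(a *: x i + y i) xi yi scaler0 addr0.
Qed.
HB.instance Definition _ :=
  GRing.isSubmodClosed.Build K (dprod V) finsupp finsupp_closed.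

Definition dsum := submod finsupp.
HB.instance Definition _ := GRing.Lmodule.on dsum.
End Product.

Section Map.
Variables (V W : I -> lmodType K) (f : forall i, {linear V i -> W i}).

Fact dsum_map_subproof (x : dsum V) :
  ((fun i => f i (val x i)) : dprod W) \in @finsupp W.
Proof.
have := submod_valP x; rewrite !inE => fx.
apply: sub_finite_set fx => i /= nz xi; apply: nz.
by rewrite (_ : val x i = 0) ?raddf0.
Qed.

Definition dsum_map_fun (x : dsum V) : dsum W := Submod (dsum_map_subproof x).

Fact dsum_map_linear : linear dsum_map_fun.
Proof.
move=> a x y; apply: val_inj; apply: functional_extensionality_dep => i /=.
exact: linearP.
Qed.

Definition dsum_map : {linear dsum V -> dsum W} :=
  HB.pack dsum_map_fun
    (GRing.isLinear.Build K _ _ _ dsum_map_fun dsum_map_linear).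
End Map.
End DirectSum.

Section DoubleComplex.
Variable K : fieldType.

Record dcomplex := DComplex {
  dc_grade :> int -> int -> lmodType K;
  d1 : forall p q, {linear dc_grade p q -> dc_grade (p + 1) q};
  d2 : forall p q, {linear dc_grade p q -> dc_grade p (q + 1)};
  d1d1 : forall p q x, d1 (p + 1) q (d1 p q x) = 0;
  d2d2 : forall p q x, d2 p (q + 1) (d2 p q x) = 0;
  d1d2 : forall p q x, d1 p (q + 1) (d2 p q x) + d2 (p + 1) q (d1 p q x) = 0
}.

Definition bounded (A : dcomplex) : Prop :=
  finite_set [set pq : int * int | exists x : A pq.1 pq.2, x <> 0].

Record bdcomplex := BDComplex {
  bdc_val :> dcomplex;
  bdc_bounded : bounded bdc_val
}.

Definition finite_dim (A : dcomplex) : Prop :=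
  forall p q, exists (n : nat) (e : {linear 'rV[K]_n -> A p q}),
    forall x, exists c, e c = x.

Record dhom (A B : dcomplex) := DHom {
  dhom_fun :> forall p q, {linear A p q -> B p q};
  dhom_d1 : forall p q x, dhom_fun (p + 1) q (d1 A p q x) = d1 B p q (dhom_fun p q x);
  dhom_d2 : forall p q x, dhom_fun p (q + 1) (d2 A p q x) = d2 B p q (dhom_fun p q x)
}.

Definition dhom_id (A : dcomplex) : dhom A A :=
  @DHom A A (fun p q => idfun) (fun _ _ _ => erefl) (fun _ _ _ => erefl).

Section Comp.
Variables (A B C : dcomplex) (g : dhom B C) (f : dhom A B).
Fact dhom_comp_d1 p q x :
  (g (p + 1) q \o f (p + 1) q) (d1 A p q x) = d1 C p q ((g p q \o f p q) x).
Proof. by rewrite /= !dhom_d1. Qed.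
Fact dhom_comp_d2 p q x :
  (g p (q + 1) \o f p (q + 1)) (d2 A p q x) = d2 C p q ((g p q \o f p q) x).
Proof. by rewrite /= !dhom_d2. Qed.
Definition dhom_comp : dhom A C :=
  @DHom A C (fun p q => g p q \o f p q) dhom_comp_d1 dhom_comp_d2.
End Comp.

Section LinearCombination.
Variables (A B : dcomplex) (a : K) (f g : dhom A B).

Definition dhom_lin_fun p q (x : A p q) : B p q := a *: f p q x + g p q x.
Fact dhom_lin_linear p q : linear (@dhom_lin_fun p q).
Proof.
move=> b x y; rewrite /dhom_lin_fun (linearP (f p q)) (linearP (g p q)) !scalerDr !scalerA (mulrC a).
by rewrite addrACA.
Qed.
HB.instance Definition _ p q :=
  GRing.isLinear.Build K _ _ _ (@dhom_lin_fun p q) (@dhom_lin_linear p q).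
Fact dhom_lin_d1 p q x : dhom_lin_fun (d1 A p q x) = d1 B p q (dhom_lin_fun x).
Proof. by rewrite /dhom_lin_fun !dhom_d1 linearP. Qed.
Fact dhom_lin_d2 p q x : dhom_lin_fun (d2 A p q x) = d2 B p q (dhom_lin_fun x).
Proof. by rewrite /dhom_lin_fun !dhom_d2 linearP. Qed.

Definition dhom_lin : dhom A B :=
  @DHom A B (fun p q => @dhom_lin_fun p q) dhom_lin_d1 dhom_lin_d2.
End LinearCombination.

Definition isomorphic (A B : dcomplex) : Prop :=
  exists f : dhom A B, forall p q, bijective (f p q).

Section DirectSumComplex.
Variables (I : Type) (A : I -> dcomplex).

Definition dcsum : dcomplex.
Proof.
refine (@DComplex (fun p q => dsum (fun i => A i p q))
  (fun p q => dsum_map (fun i => d1 (A i) p q))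
  (fun p q => dsum_map (fun i => d2 (A i) p q)) _ _ _);
  abstract (move=> p q x; apply: val_inj;
    apply: functional_extensionality_dep => i; (exact: d1d1 || exact: d2d2 || exact: d1d2)).
Defined.
End DirectSumComplex.

Section Cohomology.
Variable A : dcomplex.
Implicit Types p q : int.

(* To avoid transports between A (p - 1 + 1) q and A p q, cohomology is indexed
   by the bidegree of the source of the incoming differential:
     H_d1 p q = H_{d1}^{p+1,q},     H_d2 p q = H_{d2}^{p,q+1},
     H_BC p q = H_{BC}^{p+1,q+1},   H_A p q = H_A^{p+1,q+1}. *)
Definition H_d1 p q : lmodType K :=
  subquot (ker_of (d1 A (p + 1) q)) (im_of (d1 A p q)).

Definition H_d2 p q : lmodType K :=
  subquot (ker_of (d2 A p (q + 1))) (im_of (d2 A p q)).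

Definition d1_d2 p q : {linear A p q -> A (p + 1) (q + 1)} :=
  d1 A p (q + 1) \o d2 A p q.

Definition H_BC p q : lmodType K :=
  subquot (cap_of (ker_of (d1 A (p + 1) (q + 1))) (ker_of (d2 A (p + 1) (q + 1))))
          (im_of (d1_d2 p q)).

Definition H_A p q : lmodType K :=
  subquot (ker_of (d1_d2 (p + 1) (q + 1)))
          (sum_of (im_of (d1 A p (q + 1))) (im_of (d2 A (p + 1) q))).

End Cohomology.

Section InducedMaps.
Variables (A B : dcomplex) (f : dhom A B).
Implicit Types p q : int.

Fact ker_d1_map p q : {in ker_of (d1 A p q), forall x, f p q x \in ker_of (d1 B p q)}.
Proof. by move=> x; rewrite !inE -dhom_d1 => /eqP ->; rewrite raddf0. Qed.
Fact ker_d2_map p q : {in ker_of (d2 A p q), forall x, f p q x \in ker_of (d2 B p q)}.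
Proof. by move=> x; rewrite !inE -dhom_d2 => /eqP ->; rewrite raddf0. Qed.
Fact im_d1_map p q :
  {in im_of (d1 A p q), forall x, f (p + 1) q x \in im_of (d1 B p q)}.
Proof. by move=> x; rewrite !inE => -[y <-]; exists (f p q y); rewrite dhom_d1. Qed.
Fact im_d2_map p q :
  {in im_of (d2 A p q), forall x, f p (q + 1) x \in im_of (d2 B p q)}.
Proof. by move=> x; rewrite !inE => -[y <-]; exists (f p q y); rewrite dhom_d2. Qed.
Fact ker_d1_d2_map p q :
  {in ker_of (d1_d2 A p q), forall x, f p q x \in ker_of (d1_d2 B p q)}.
Proof. by move=> x; rewrite !inE /= -dhom_d2 -dhom_d1 => /eqP ->; rewrite raddf0. Qed.
Fact im_d1_d2_map p q :
  {in im_of (d1_d2 A p q), forall x, f (p + 1) (q + 1) x \in im_of (d1_d2 B p q)}.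
Proof.
by move=> x; rewrite !inE => -[y <-]; exists (f p q y); rewrite /= dhom_d1 dhom_d2.
Qed.
Fact ker_ker_map p q :
  {in cap_of (ker_of (d1 A p q)) (ker_of (d2 A p q)), forall x,
     f p q x \in cap_of (ker_of (d1 B p q)) (ker_of (d2 B p q))}.
Proof.
by move=> x /andP[x1 x2]; apply/andP; split; [exact: ker_d1_map|exact: ker_d2_map].
Qed.
Fact im_im_map p q :
  {in sum_of (im_of (d1 A p (q + 1))) (im_of (d2 A (p + 1) q)), forall x,
     f (p + 1) (q + 1) x \in sum_of (im_of (d1 B p (q + 1))) (im_of (d2 B (p + 1) q))}.
Proof.
move=> x; rewrite inE => -[s [t [s1 t2 ->]]]; rewrite inE.
exists (f (p + 1) (q + 1) s), (f (p + 1) (q + 1) t).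
by split; [exact: im_d1_map|exact: im_d2_map|rewrite raddfD].
Qed.

Definition H_d1_map p q : {linear H_d1 A p q -> H_d1 B p q} :=
  subquot_map (@ker_d1_map (p + 1) q) (@im_d1_map p q).
Definition H_d2_map p q : {linear H_d2 A p q -> H_d2 B p q} :=
  subquot_map (@ker_d2_map p (q + 1)) (@im_d2_map p q).
Definition H_BC_map p q : {linear H_BC A p q -> H_BC B p q} :=
  subquot_map (@ker_ker_map (p + 1) (q + 1)) (@im_d1_d2_map p q).
Definition H_A_map p q : {linear H_A A p q -> H_A B p q} :=
  subquot_map (@ker_d1_d2_map (p + 1) (q + 1)) (@im_im_map p q).

Definition E1_isomorphism : Prop :=
  (forall p q, bijective (H_d1_map p q)) /\ (forall p q, bijective (H_d2_map p q)).

End InducedMaps.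

Record linear_functor := LinearFunctor {
  lf_obj :> bdcomplex -> lmodType K;
  lf_map : forall A B : bdcomplex, dhom A B -> {linear lf_obj A -> lf_obj B};
  lf_id : forall A : bdcomplex, lf_map (dhom_id A) =1 id;
  lf_comp : forall (A B C : bdcomplex) (g : dhom B C) (f : dhom A B),
    @lf_map A C (dhom_comp g f) =1 lf_map g \o lf_map f;
  lf_lin : forall (A B : bdcomplex) (a : K) (f g : dhom A B) x,
    lf_map (dhom_lin a f g) x = a *: lf_map f x + lf_map g x
}.

End DoubleComplex.

(* Distinct codes have distinct sets of points, so that shapes and codes are
   interchangeable. Zigzag1 r and Zigzag2 r are the even shapes S_{1,r+1} and
   S_{2,r+1}: the length parameter is shifted so that it is never 0. *)
Variant dshape :=
  | Square of int & int
  | Zigzag1 of nat & int & int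
  | Zigzag2 of nat & int & int
  | ZigzagOdd of int & int & int.

Definition is_square (S : dshape) : bool := if S is Square _ _ then true else false.
Definition is_zigzag (S : dshape) : bool := ~~ is_square S.

Definition points (S : dshape) : set (int * int) :=
  match S with
  | Square p q => [set (p, q); (p - 1, q); (p, q - 1); (p - 1, q - 1)]
  | Zigzag1 r p q =>
      [set (p + j%:Z, q - j%:Z) | j in [set j : nat | (j <= r)%N]] `|`
      [set (p + j%:Z + 1, q - j%:Z) | j in [set j : nat | (j <= r)%N]]
  | Zigzag2 r p q =>
      [set (p - j%:Z, q + j%:Z) | j in [set j : nat | (j <= r)%N]] `|`
      [set (p - j%:Z, q + j%:Z + 1) | j in [set j : nat | (j <= r)%N]]
  | ZigzagOdd d p q =>
      if p + q <= d then
        [set (j, d - j) | j in [set j : int | p <= j <= d - q]] `|`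
        [set (j, d + 1 - j) | j in [set j : int | p + 1 <= j <= d - q]]
      else
        [set (j, d - j) | j in [set j : int | d - q <= j <= p]] `|`
        [set (j, d - 1 - j) | j in [set j : int | d - q <= j <= p - 1]]
  end.

Definition pointsb (S : dshape) (p q : int) : bool :=
  match S with
  | Square a b => ((p == a) || (p == a - 1)) && ((q == b) || (q == b - 1))
  | Zigzag1 r a b =>
      ((p + q == a + b) && (a <= p <= a + r%:Z)) ||
      ((p + q == a + b + 1) && (a + 1 <= p <= a + r%:Z + 1))
  | Zigzag2 r a b =>
      ((p + q == a + b) && (a - r%:Z <= p <= a)) ||
      ((p + q == a + b + 1) && (a - r%:Z <= p <= a))
  | ZigzagOdd d a b =>
      (a + b <= d) && (((p + q == d) && (a <= p <= d - b)) ||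
                       ((p + q == d + 1) && (a + 1 <= p <= d - b))) ||
      (d < a + b) && (((p + q == d) && (d - b <= p <= a)) ||
                      ((p + q == d - 1) && (d - b <= p <= a - 1)))
  end.

Lemma in_points S p q : ((p, q) \in points S) = pointsb S p q.
Proof.
apply/idP/idP; rewrite inE; case: S => [a b|r a b|r a b|d a b] /=.
- by move=> [[[|]|]|] [-> ->]; lia.
- by move=> [|] [j /= jr [<- <-]]; lia.
- by move=> [|] [j /= jr [<- <-]]; lia.
- by case: ifP => abd [|] [j /= jr [<- <-]]; lia.
- by case/andP=> /orP[]/eqP-> /orP[]/eqP->; rewrite /setU /=; tauto.
- move=> /orP[] h; [left|right].
    by exists (absz (p - a)%R) => /=; [|congr pair]; lia.
  by exists (absz (p - a - 1)%R) => /=; [|congr pair]; lia.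
- move=> /orP[] h; [left|right].
    by exists (absz (p - a)%R) => /=; [|congr pair]; lia.
  by exists (absz (p - a)%R) => /=; [|congr pair]; lia.
- case: ifP => abd h; (have [pd|pd] := eqVneq (p + q) d; [left|right]);
  by exists p => /=; [|congr pair]; lia.
Qed.

Section ShapeComplex.
Variables (K : fieldType) (S : dshape).

Definition C_grade (p q : int) : lmodType K := 'rV[K]_((p, q) \in points S).

(* A constant matrix of size b x b' is invertible for b = b' = 1 and is the only
   matrix of its size otherwise; the sign (-1)^p makes squares anticommute. *)
Definition C_d1 p q : {linear C_grade p q -> C_grade (p + 1) q} :=
  mulmxr (const_mx 1).
Definition C_d2 p q : {linear C_grade p q -> C_grade p (q + 1)} :=
  mulmxr (const_mx ((-1) ^ p)).

Lemma mul_const_mx2 (b b' b'' : bool) (c c' : K) (x : 'rV_b) :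
  x *m (const_mx c : 'M_(b, b')) *m (const_mx c' : 'M_(b', b'')) =
  x *m const_mx (c * c' *+ b').
Proof.
rewrite -mulmxA; congr mulmx; apply/matrixP => i j; rewrite !mxE.
rewrite (eq_bigr (fun=> c * c')) => [|k _]; last by rewrite !mxE.
by rewrite sumr_const card_ord.
Qed.

Lemma mul_const_mx0 (b b'' : bool) (c : K) (x : 'rV_b) :
  (b -> b'' -> c = 0) -> x *m (const_mx c : 'M_(b, b'')) = 0.
Proof.
move=> c0; apply/rowP => j; rewrite !mxE; apply: big1 => i _; rewrite !mxE.
have b1 : b by case: (b) i => // -[].
have b2 : b'' by case: (b'') j => // -[].
by rewrite c0 ?mulr0.
Qed.

Fact C_d1d1 p q x : C_d1 (p + 1) q (C_d1 p q x) = 0.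
Proof.
rewrite /= mul_const_mx2; apply: mul_const_mx0; rewrite !in_points => h h'.
suff -> : pointsb S (p + 1) q = false by rewrite mulr0n.
by case: S h h' => * /=; simpl in *; lia.
Qed.

Fact C_d2d2 p q x : C_d2 p (q + 1) (C_d2 p q x) = 0.
Proof.
rewrite /= mul_const_mx2; apply: mul_const_mx0; rewrite !in_points => h h'.
suff -> : pointsb S p (q + 1) = false by rewrite mulr0n.
by case: S h h' => * /=; simpl in *; lia.
Qed.

Fact C_d1d2 p q x :
  C_d1 p (q + 1) (C_d2 p q x) + C_d2 (p + 1) q (C_d1 p q x) = 0.
Proof.
rewrite /= !mul_const_mx2 -mulmxDr.
rewrite (_ : const_mx _ + const_mx _ = const_mx
  ((-1) ^ p * 1 *+ ((p, q + 1) \in points S) +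
   1 * (-1) ^ (p + 1) *+ ((p + 1, q) \in points S))); last first.
  by apply/matrixP => i j; rewrite !mxE.
apply: mul_const_mx0; rewrite !in_points => h h'.
suff -> : pointsb S (p + 1) q = pointsb S p (q + 1).
  by rewrite expfzDr ?oppr_eq0 ?oner_eq0 // expr1z mul1r mulr1 mulrN1 mulNrn subrr.
by case: S h h' => * /=; simpl in *; lia.
Qed.

Definition shapeC : dcomplex K := DComplex C_d1d1 C_d2d2 C_d1d2.

(* shapeC has the properties which define it up to isomorphism; its component in
   bidegree (p, q) has dimension ((p, q) \in points S) by construction. *)
Lemma C_d1_bij p q : (p, q) \in points S -> (p + 1, q) \in points S ->
  bijective (d1 shapeC p q).
Proof.
rewrite /= /C_d1 /C_grade; move: (_ \in _) (_ \in _) => b b' bT b'T.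
case: b b' bT b'T => [] [] // _ _; exists id => x; apply/rowP => j;
by rewrite mxE big_ord1 mxE mulr1 (ord1 j).
Qed.

Lemma C_d2_bij p q : (p, q) \in points S -> (p, q + 1) \in points S ->
  bijective (d2 shapeC p q).
Proof.
rewrite /= /C_d2 /C_grade; move: (_ \in _) (_ \in _) => b b' bT b'T.
have u : (-1) ^ p != 0 :> K by rewrite expfz_neq0 // oppr_eq0 oner_eq0.
case: b b' bT b'T => [] [] // _ _.
exists (fun x : 'rV[K]_1 => ((-1 : K) ^ p)^-1 *: x) => x; apply/rowP => j;
by rewrite !mxE big_ord1 !mxE (ord1 j) mulrC ?mulfK // mulrA mulfV // mul1r.
Qed.

End ShapeComplex.

Section Multiplicity.
Variable K : fieldType.

(* A is isomorphic to the direct sum over all shapes S of mult S copies of C(S),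
   the cardinal mult S being represented by a type. *)
Definition multiplicities (A : dcomplex K) (mult : dshape -> Type) : Prop :=
  isomorphic A (dcsum (fun Si : {S : dshape & mult S} => shapeC K (projT1 Si))).

Definition equipotent (X Y : Type) : Prop := exists h : X -> Y, bijective h.

Definition vanishes (F : linear_functor K) (X : bdcomplex K) : Prop :=
  forall v : F X, v = 0.

Definition kills_squares (F : linear_functor K) : Prop :=
  forall (S : dshape) (X : bdcomplex K), is_square S ->
    isomorphic X (shapeC K S) -> vanishes F X.

(* A linear functor which vanishes on every single square need not vanish on an
   infinite direct sum of squares, e.g. X |-> Hom(W, X^{0,0}) / {finite rank}
   for W of infinite dimension. *)
Definition kills_square_sums (F : linear_functor K) : Prop :=
  forall (S : dshape) (I : Type) (X : bdcomplex K), is_square S ->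
    isomorphic X (dcsum (fun _ : I => shapeC K S)) -> vanishes F X.

End Multiplicity.

(* Main.v *)
Require Import Defs.
From HB Require Import structures.
From mathcomp Require Import all_boot all_order all_algebra.
From mathcomp Require Import boolp classical_sets functions cardinality.
From mathcomp Require Import fsbigop zify.

Set Implicit Arguments.
Unset Strict Implicit.
Unset Printing Implicit Defensive.

Import Order.TTheory GRing.Theory Num.Theory.
Local Open Scope classical_set_scope.
Local Open Scope ring_scope.

(* Call a morphism null if it is of the form
     [d1, [d2, h]] = d1 d2 h + d2 h d1 - d1 h d2 + h d1 d2
   with h linear of bidegree (-1, -1); null morphisms are those which factor
   through sums of squares. An E_1-isomorphism f : A -> B has an inverse up to
   null morphisms. Indeed, let P(B) be the free double complex on B. By induction
   on the first degree, every element killed by both differentials in the kernel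
   of A + P(B) -> B lies in the image of d1 d2. This makes the identity of the
   kernel null, and the components of a null-homotopy provide g : B -> A with
   1 - g f null. As g is again an E_1-isomorphism, f is inverted by every functor
   which kills null morphisms, such as H_BC, H_A and the linear functors which
   vanish on sums of squares.
   If S is a zigzag, then null endomorphisms of C(S) vanish, and so do all
   composites C(S) -> C(S') -> C(S) with S' <> S. Hence f and g restrict to
   linear maps between the multiplicity spaces of S with g f = 1, so that the
   Steinitz exchange argument and the Cantor-Bernstein theorem give
   mult_S(A) = mult_S(B). Conversely, a map which is bijective between the
   zigzags and zero on the squares is an E_1-isomorphism. *)

(** * Linear algebra over a field *)

Definition linear_of (K : fieldType) (U V : lmodType K) (f : U -> V)
    (lf : linear f) : {linear U -> V} :=
  HB.pack f (GRing.isLinear.Build K U V _ f lf).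

Section LinearRelations.
Variables (K : fieldType) (V U : lmodType K).

Definition linrel (R : set (V * U)) : Prop :=
  R (0, 0) /\ forall a x y, R x -> R y -> R (a *: x + y).

Definition functional (R : set (V * U)) : Prop := forall u, R (0, u) -> u = 0.

(** By Zorn's lemma there is a maximal single-valued linear relation between [R0] and [R]. It is
    defined on all of [V]: at a vector [v] outside its domain, the line through some [(v, u0)] in
    [R] could be adjoined. This takes the place of choosing bases and complements. *)
Lemma linear_interpolation (R0 R : set (V * U)) :
  linrel R0 -> functional R0 -> R0 `<=` R -> linrel R ->
  (forall v, exists u, R (v, u)) ->
  exists s : {linear V -> U},
    (forall v, R (v, s v)) /\ (forall v u, R0 (v, u) -> s v = u).
Proof.
move=> lR0 fR0 R0R lR totR.
(* The conditions are imposed on the union with [R0], so that the empty chain satisfies them. *)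
pose P (A : set (V * U)) :=
  [/\ linrel (A `|` R0), functional (A `|` R0) & A `<=` R].
have [F FP Fch|G [[lG fG GR] Gmax]] := @Zorn_bigcup _ P.
  have pick x y : ((\bigcup_(X in F) X) `|` R0) x ->
      ((\bigcup_(X in F) X) `|` R0) y ->
      (R0 x /\ R0 y) \/ exists2 X, F X & (X `|` R0) x /\ (X `|` R0) y.
    move=> [[X FX Xx]|R0x] [[Y FY Yy]|R0y]; last by left.
    - have [XY|YX] := Fch _ _ FX FY; right; [exists Y|exists X] => //.
      + by split; left=> //; apply: XY.
      + by split; left=> //; apply: YX.
    - by right; exists X => //; split; [left|right].
    - by right; exists Y => //; split; [right|left].
  split.
  - split=> [|a x y Hx Hy]; first by right; case: lR0.
    have [[Rx Ry]|[X FX [Xx Xy]]] := pick x y Hx Hy.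
      by right; apply: lR0.2.
    by have [[_ /(_ a x y Xx Xy) [?|?]] _ _] := FP _ FX; [left; exists X|right].
  - move=> u [[X FX Xu]|]; last exact: fR0.
    by have [_ + _] := FP _ FX; apply; left.
  - by move=> x [X FX Xx]; have [_ _ +] := FP _ FX; apply.
pose H := G `|` R0.
have HR : H `<=` R by move=> x [/GR|/R0R].
have domH v : exists u, H (v, u).
  apply: contrapT => nv; have [u0 Ru0] := totR v.
  pose G' := [set z : V * U | exists c x, H x /\ z = c *: (v, u0) + x].
  have HG' : H `<=` G' by move=> x Hx; exists 0, x; rewrite scale0r add0r.
  have G'R0 : G' `|` R0 = G'.
    by apply/seteqP; split=> x; [case=> // R0x; apply: HG'; right|left].
  apply: (Gmax G'); first split.
  - by move=> x Gx; apply: HG'; left.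
  - move=> /(_ (v, u0)) G'G; apply: nv; exists u0; left; apply: G'G.
    by exists 1, 0; rewrite scale1r addr0; split=> //; case: lG.
  - split; rewrite ?G'R0.
    + split=> [|a x y [c [x' [Hx ->]]] [d [y' [Hy ->]]]].
        by apply: HG'; case: lG.
      exists (a * c + d), (a *: x' + y'); split; first exact: lG.2.
      by rewrite scalerDr scalerA addrACA -scalerDl.
    + move=> u [c [[x1 x2] [Hx [e1 e2]]]]; have [c0|c0] := eqVneq c 0.
        rewrite c0 scale0r add0r in e1.
        by rewrite e2 c0 scale0r add0r; apply: fG; rewrite {1}e1.
      (* For [c] nonzero, [v] would be a multiple of a vector in the domain of [H]. *)
      case: nv; exists (- c^-1 *: x2).
      have -> : v = - c^-1 *: x1.
        by rewrite scaleNr -scalerN -(addKr (c *: v) x1) -e1 addr0 opprK scalerK.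
      have [H0 HL] := lG.
      by have := HL (- c^-1) (x1, x2) 0 Hx H0; rewrite addr0.
    + move=> x [c [x' [Hx ->]]]; apply: lR.2 => //; exact: HR.
have [s Hs] := choice domH.
have Huniq v u u' : H (v, u) -> H (v, u') -> u = u'.
  move=> Hu Hu'; apply/subr0_eq/fG.
  have := lG.2 (-1) _ _ Hu' Hu.
  rewrite scaleN1r (_ : - (v, u') + (v, u) = (0, u - u')) //.
  by congr pair; rewrite /= addrC ?subrr.
have ls : linear s.
  move=> a x y; apply: (Huniq (a *: x + y)); first exact: Hs.
  by have := lG.2 a _ _ (Hs x) (Hs y).
exists (linear_of ls); split=> [v|v u R0u] /=; first exact: HR.
by apply: (Huniq v); [exact: Hs|right].
Qed.

End LinearRelations.

Lemma pseudo_inverse (K : fieldType) (U V : lmodType K) (f : {linear U -> V}) :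
  exists s : {linear V -> U}, forall u, f (s (f u)) = f u.
Proof.
pose im v := exists u, f u = v.
have im0 : im 0 by exists 0; rewrite linear0.
have imP a x y : im x -> im y -> im (a *: x + y).
  by move=> [x' <-] [y' <-]; exists (a *: x' + y'); rewrite linearP.
(* [p] extends the identity of the image of [f] to a projection of [V] onto this image. *)
have [||||v|p [pim pid]] := @linear_interpolation K V V
  [set z | im z.1 /\ z.2 = z.1] [set z | im z.2].
- by split=> // a x y [/= ? ex] [/= ? ey]; split; [exact: imP|rewrite /= ex ey].
- by move=> u [_ /= ->].
- by move=> [v w] [/= ? ->].
- by split=> // a x y ? ?; apply: imP.
- by exists 0.
(* [s] lifts [p] along [f]; only the value at 0 is prescribed. *)
have [||||v|s [sp _]] := @linear_interpolation K V U
  [set z | z = 0] [set z | f z.2 = p z.1].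
- by split=> // a x y /= -> ->; rewrite scaler0 addr0.
- by move=> u [].
- by move=> z -> /=; rewrite !linear0.
- by split=> [|a x y /= hx hy]; rewrite /= ?linear0 // !linearP hx hy.
- by have [u fu] := pim v; exists u.
by exists s => u; rewrite sp (pid _ (f u)) //; split=> //; exists u.
Qed.

(** * Null maps and contractions *)

(** The iterated graded commutator of [d1], [d2] and an even operator [h]. The last sign is positive
    because [d2 d1 = - d1 d2]. Here [h] is an arbitrary map; the bigrading enters only with
    [sqhom]. *)
Definition sqmap (K : fieldType) (T T' : lmodType K) (d1 d2 : T -> T)
    (d1' d2' : T' -> T') (h : T -> T') (x : T) : T' :=
  d1' (d2' (h x)) + d2' (h (d1 x)) - d1' (h (d2 x)) + h (d1 (d2 x)).

Section Exterior.
Variables (K : fieldType) (T T' : lmodType K).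
Variables (d1 d2 : {linear T -> T}) (d1' d2' : {linear T' -> T'}).
Hypothesis (d11 : forall x, d1 (d1 x) = 0) (d22 : forall x, d2 (d2 x) = 0).
Hypothesis d12 : forall x, d2 (d1 x) = - d1 (d2 x).
Hypothesis (d11' : forall x, d1' (d1' x) = 0) (d22' : forall x, d2' (d2' x) = 0).
Hypothesis d12' : forall x, d2' (d1' x) = - d1' (d2' x).
Variable h : {linear T -> T'}.

Lemma sqmap_linear : linear (sqmap d1 d2 d1' d2' h).
Proof.
exact: (linearP ((((d1' \o d2') \o h) \+ ((d2' \o h) \o d1)
  \- ((d1' \o h) \o d2)) \+ ((h \o d1) \o d2) : {linear T -> T'})).
Qed.
HB.instance Definition _ := GRing.isLinear.Build K T T' _ _ sqmap_linear.

(** Taking the graded commutator with [d1] twice gives 0, and exchanging [d1] and [d2] only changes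
    the sign of the iterated commutator. So null maps are chain maps. *)
Lemma sqmap_d1 x : sqmap d1 d2 d1' d2' h (d1 x) = d1' (sqmap d1 d2 d1' d2' h x).
Proof.
rewrite /sqmap !(linearD, linearB, linearN).
rewrite ?(d11, d11', d12) ?linear0 ?linearN /= ?d11 ?d11' ?linear0.
by rewrite opprK !(addr0, add0r).
Qed.

Lemma sqmap_d2 x : sqmap d1 d2 d1' d2' h (d2 x) = d2' (sqmap d1 d2 d1' d2' h x).
Proof.
rewrite /sqmap !(linearD, linearB, linearN).
rewrite ?(d22, d22', d12') ?linear0 ?linearN /= ?d22 ?d22' ?linear0.
by rewrite opprK !(addr0, add0r).
Qed.

End Exterior.

Section Contraction.
Variables (K : fieldType) (T : lmodType K) (d1 d2 : {linear T -> T}).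
Hypothesis (d11 : forall x, d1 (d1 x) = 0) (d22 : forall x, d2 (d2 x) = 0).
Hypothesis d12 : forall x, d2 (d1 x) = - d1 (d2 x).
Hypothesis socle : forall x, d1 x = 0 -> d2 x = 0 -> exists y, x = d1 (d2 y).

(* A section h of d1 d2 gives a chain map sqmap h which is the identity on the
   socle, hence is 1 - psi with psi ^+ 3 = 0. *)
Lemma contraction : exists h : {linear T -> T}, forall x, sqmap d1 d2 d1 d2 h x = x.
Proof.
have [h hK] := pseudo_inverse (d1 \o d2); rewrite /= in hK.
pose phi : {linear T -> T} := sqmap d1 d2 d1 d2 h.
have phi1 x : phi (d1 x) = d1 (phi x) by exact: sqmap_d1.
have phi2 x : phi (d2 x) = d2 (phi x) by exact: sqmap_d2.
have phi12 y : phi (d1 (d2 y)) = d1 (d2 y).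
  have z : d2 (d1 (d2 y)) = 0 by rewrite d12 d22 linear0 oppr0.
  by rewrite /phi /= /sqmap hK d11 z !linear0 !addr0.
have phis x : d1 x = 0 -> d2 x = 0 -> phi x = x.
  by move=> x1 x2; have [y ->] := socle x1 x2.
pose psi : {linear T -> T} := idfun \- phi.
have psiE x : psi x = x - phi x by [].
have psi1 x : psi (d1 x) = d1 (psi x) by rewrite !psiE phi1 linearB.
have psi2 x : psi (d2 x) = d2 (psi x) by rewrite !psiE phi2 linearB.
(* As [psi] kills the image of [d1 d2], both differentials send [psi x] into the socle, which [psi]
   kills; hence [psi (psi x)] lies in the socle itself. *)
have psi3 x : psi (psi (psi x)) = 0.
  have z12 : d1 (d2 (psi x)) = 0 by rewrite -psi2 -psi1 psiE phi12 subrr.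
  rewrite [LHS]psiE phis ?subrr //.
    by rewrite -psi1 psiE phis ?subrr // d12 z12 oppr0.
  by rewrite -psi2 psiE phis ?subrr.
(* The geometric series inverting [phi = 1 - psi]. It commutes with both differentials, so it can be
   absorbed into [h]. *)
pose th : {linear T -> T} := (idfun \+ psi) \+ (psi \o psi).
have thE x : th x = x + psi x + psi (psi x) by [].
have th1 x : th (d1 x) = d1 (th x) by rewrite !thE !psi1 !linearD.
have th2 x : th (d2 x) = d2 (th x) by rewrite !thE !psi2 !linearD.
exists (h \o th) => x; rewrite -[LHS]/(d1 (d2 (h (th x))) +
  d2 (h (th (d1 x))) - d1 (h (th (d2 x))) + h (th (d1 (d2 x)))).
rewrite !(th1, th2) -[LHS]/(phi (th x)).
have -> : phi (th x) = th x - psi (th x) by rewrite psiE opprB addrC subrK.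
have -> : psi (th x) = psi x + psi (psi x).
  by rewrite thE 2!(linearD psi) psi3 addr0.
by rewrite thE -[x + _ + _]addrA addrK.
Qed.

End Contraction.

(** * Inverting a morphism up to null maps *)

Section StableInverse.
Variables (K : fieldType) (A B : lmodType K).
Variables (a1 a2 : {linear A -> A}) (b1 b2 : {linear B -> B}) (f : {linear A -> B}).
Hypothesis (a11 : forall x, a1 (a1 x) = 0) (a22 : forall x, a2 (a2 x) = 0).
Hypothesis a12 : forall x, a2 (a1 x) = - a1 (a2 x).
Hypothesis (b11 : forall x, b1 (b1 x) = 0) (b22 : forall x, b2 (b2 x) = 0).
Hypothesis b12 : forall x, b2 (b1 x) = - b1 (b2 x).
Hypothesis (f1 : forall x, f (a1 x) = b1 (f x)) (f2 : forall x, f (a2 x) = b2 (f x)).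
Hypothesis fP : forall a b, a1 a = 0 -> a2 a = 0 -> f a = b1 (b2 b) ->
  exists a' u v, a = a1 (a2 a') /\ f a' - b = b1 u + b2 v.

(* The kernel of A + P(B) -> B, where P(B) = B + d1 B + d2 B + d1 d2 B is the
   free double complex on B; coord0 recovers the first coordinate in P(B). *)
Let cone : lmodType K := (A * (B * (B * B)))%type.
Let coord0 (x : cone) : B := - (f x.1 + b1 x.2.1 + b2 x.2.2.1 + b1 (b2 x.2.2.2)).
Let k1 (x : cone) : cone := (a1 x.1, (coord0 x, (0, x.2.2.1))).
Let k2 (x : cone) : cone := (a2 x.1, (0, (coord0 x, - x.2.1))).

Let coord0P : linear coord0.
Proof.
exact: (linearP (\- (f \o fst \+ (b1 \o (fst \o snd)) \+ (b2 \o (fst \o (snd \o snd)))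
  \+ ((b1 \o b2) \o (snd \o (snd \o snd)))) : {linear cone -> B})).
Qed.

(** Hypothesis [fP] says that the socle of [cone] lies in the image of the two differentials
    composed, so [contraction] makes the identity of [cone] null. The component in [A] of this
    null-homotopy, restricted to the four summands of [cone], yields [k] and [g]. *)
Lemma stable_inverse : exists (g : {linear B -> A}) (k : {linear A -> A}),
  [/\ forall x, g (b1 x) = a1 (g x), forall x, g (b2 x) = a2 (g x)
    & forall x, g (f x) = x - sqmap a1 a2 a1 a2 k x].
Proof.
have coneE (x y : cone) : x.1 = y.1 -> x.2.1 = y.2.1 -> x.2.2.1 = y.2.2.1 ->
    x.2.2.2 = y.2.2.2 -> x = y.
  by case: x y => [? [? [? ?]]] [? [? [? ?]]] /= -> -> -> ->.
have k1P : linear k1.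
  move=> c x y; apply: coneE => /=; [exact: linearP|exact: coord0P| |by []].
  by rewrite scaler0 addr0.
have k2P : linear k2.
  move=> c x y; apply: coneE => /=; [exact: linearP| |exact: coord0P|].
    by rewrite scaler0 addr0.
  by rewrite scalerN -opprD.
have b1c x : b1 (coord0 x) = - (b1 (f x.1) + b1 (b2 x.2.2.1)).
  by rewrite (linearN b1) !(linearD b1) !b11 !addr0.
have b2c x : b2 (coord0 x) = - (b2 (f x.1) - b1 (b2 x.2.1)).
  by rewrite (linearN b2) !(linearD b2) !b12 !b22 (linear0 b1) subr0 addr0.
have c1 x : coord0 (k1 x) = 0.
  have z (p q : B) : p - (p + q) + q = 0 by rewrite opprD addrA subrr add0r addNr.
  by rewrite {1}/coord0 /= f1 b1c (linear0 b2) addr0 z oppr0.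
have c2 x : coord0 (k2 x) = 0.
  rewrite {1}/coord0 /= f2 b2c (linear0 b1) addr0 (linearN b2) (linearN b1).
  by rewrite subKr subrr oppr0.
have [x|x|x|x e1 e2|h hP] := @contraction K cone (linear_of k1P) (linear_of k2P).
- by apply: coneE; rewrite //= ?a11 ?c1.
- by apply: coneE; rewrite //= ?a22 ?c2 ?oppr0.
- by apply: coneE; rewrite //= ?a12 ?c1 ?c2 ?oppr0 ?opprK.
- have x1 : x.2.1 = 0.
    by have /eqP := congr1 (fun y : cone => y.2.2.2) e2; rewrite oppr_eq0 => /eqP.
  have x2 : x.2.2.1 = 0 by have := congr1 (fun y : cone => y.2.2.2) e1.
  have [||/=|a' [u [v [a'E uv]]]] := @fP x.1 (- x.2.2.2).
  + exact: (congr1 (fun y : cone => y.1) e1).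
  + exact: (congr1 (fun y : cone => y.1) e2).
  + have /eqP := congr1 (fun y : cone => y.2.1) e1; rewrite /= oppr_eq0.
    rewrite x1 x2 (linear0 b1) (linear0 b2) !addr0 => /eqP.
    by rewrite (linearN b2) (linearN b1) => /eqP; rewrite addr_eq0 => /eqP.
  (* The entries [- u] and [- v] make [coord0] of this element equal to [x.2.2.2], which is the only
     nonzero coordinate in [P(B)] that the two differentials produce from it. *)
  + exists (a', (- u, (- v, 0))); apply: coneE; rewrite //= ?c2 //.
    rewrite /coord0 /= (linearN b1) (linearN b2) (linear0 b2) (linear0 b1) addr0.
    by rewrite -addrA -opprD -uv opprB opprK addrAC subrr add0r.
(* From here on only the component in [A] of the identity [hP] is used. *)
pose eta (x : cone) : A := (h x).1.
have etaN x : eta (- x) = - eta x by rewrite /eta linearN.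
have etaD x y : eta (x + y) = eta x + eta y by rewrite /eta linearD.
have etaP x : a1 (a2 (eta x)) + a2 (eta (k1 x)) - a1 (eta (k2 x)) +
    eta (k1 (k2 x)) = x.1 := congr1 (fun y : cone => y.1) (hP x).
pose i0 a : cone := (a, (0, (0, 0))); pose i1 b : cone := (0, (b, (0, 0))).
pose i2 b : cone := (0, (0, (b, 0))); pose i3 b : cone := (0, (0, (0, b))).
have i0P : linear (eta \o i0).
  move=> c x y; rewrite /= (_ : i0 _ = c *: i0 x + i0 y) /eta ?linearP //.
  by apply: coneE; rewrite /= ?scaler0 ?addr0.
have i1P : linear (eta \o i1).
  move=> c x y; rewrite /= (_ : i1 _ = c *: i1 x + i1 y) /eta ?linearP //.
  by apply: coneE; rewrite /= ?scaler0 ?addr0.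
have i2P : linear (eta \o i2).
  move=> c x y; rewrite /= (_ : i2 _ = c *: i2 x + i2 y) /eta ?linearP //.
  by apply: coneE; rewrite /= ?scaler0 ?addr0.
have i3P : linear (eta \o i3).
  move=> c x y; rewrite /= (_ : i3 _ = c *: i3 x + i3 y) /eta ?linearP //.
  by apply: coneE; rewrite /= ?scaler0 ?addr0.
(* The combination is read off from [etaP]: at [i1 x] it gives compatibility with the first
   differential, at [i2 x] with the second, and at [i0 x] the formula for [g (f x)]. *)
pose g : {linear B -> A} :=
  (\- (a2 \o linear_of i1P) \+ (a1 \o linear_of i2P)) \- linear_of i3P.
have gE b : g b = - a2 (eta (i1 b)) + a1 (eta (i2 b)) - eta (i3 b) by [].
exists g, (linear_of i0P); split=> x.
- have := etaP (i1 x).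
  rewrite (_ : k1 (k2 (i1 x)) = - i3 (b1 x)); last first.
    by apply: coneE; rewrite /= ?c2 /coord0 /= ?(linear0, addr0, add0r, oppr0).
  rewrite (_ : k1 (i1 x) = - i1 (b1 x)); last first.
    by apply: coneE; rewrite /= /coord0 /= ?(linear0, addr0, add0r, oppr0).
  rewrite (_ : k2 (i1 x) = - (i2 (b1 x) + i3 x)); last first.
    by apply: coneE; rewrite /= /coord0 /= ?(linear0, addr0, add0r, oppr0).
  rewrite !etaN etaD (linearN a1) (linearN a2) (linearD a1) opprK !gE.
  rewrite (linearB a1) (linearD a1) (linearN a1) a11 addr0 => /= e.
  apply/subr0_eq; rewrite -[RHS]e opprD !opprK !addrA.
  by rewrite [LHS](ACl (4*1*2*5*3))%AC.
- have := etaP (i2 x).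
  rewrite (_ : k1 (k2 (i2 x)) = - i3 (b2 x)); last first.
    by apply: coneE; rewrite /= ?c2 /coord0 /= ?(linear0, addr0, add0r, oppr0).
  rewrite (_ : k1 (i2 x) = i3 x - i1 (b2 x)); last first.
    by apply: coneE; rewrite /= /coord0 /= ?(linear0, addr0, add0r, oppr0).
  rewrite (_ : k2 (i2 x) = - i2 (b2 x)); last first.
    by apply: coneE; rewrite /= /coord0 /= ?(linear0, addr0, add0r, oppr0).
  rewrite etaD !etaN (linearB a2) (linearN a1) opprK !gE.
  rewrite (linearB a2) (linearD a2) (linearN a2) a22 oppr0 add0r a12 => /= e.
  apply/subr0_eq; rewrite -[RHS]e opprD !opprK !addrA.
  by rewrite [LHS](ACl (4*5*1*2*3))%AC.
- have := etaP (i0 x).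
  rewrite (_ : k1 (k2 (i0 x)) = i0 (a1 (a2 x)) - i3 (f x)); last first.
    by apply: coneE; rewrite /= ?c2 /coord0 /= ?(linear0, addr0, add0r, oppr0).
  rewrite (_ : k1 (i0 x) = i0 (a1 x) - i1 (f x)); last first.
    by apply: coneE; rewrite /= /coord0 /= ?(linear0, addr0, add0r, oppr0).
  rewrite (_ : k2 (i0 x) = i0 (a2 x) - i2 (f x)); last first.
    by apply: coneE; rewrite /= /coord0 /= ?(linear0, addr0, add0r, oppr0).
  rewrite !etaD !etaN (linearB a1) (linearB a2) gE /= => e.
  apply/esym/eqP; rewrite subr_eq -[X in X == _]e /sqmap /= !opprD !opprK !addrA.
  by apply/eqP; rewrite [LHS](ACl (3*5*7*1*2*4*6))%AC.
Qed.

End StableInverse.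

(** * Total spaces *)

Section TotalSpace.
Variable K : fieldType.
Implicit Types A B : dcomplex K.

(* The product, rather than the sum, of all bidegrees: then a family of
   elements, one for each bidegree, is an element of the total space. *)
Definition tot A : lmodType K := dprod (fun p => dprod (fun q => A p q) : lmodType K).

Lemma tot_ext A (x y : tot A) : (forall p q, x p q = y p q) -> x = y.
Proof.
by move=> xy; apply: functional_extensionality_dep => p;
  apply: functional_extensionality_dep => q.
Qed.

(** Every degree is a successor, so a claim about all bidegrees can be checked at the targets of a
    differential, where [td1E] involves no transport. *)
Lemma totS1 (P : int -> int -> Prop) :
  (forall p q, P (p + 1) q) -> forall p q, P p q.
Proof. by move=> h p q; rewrite -(subrK 1 p). Qed.

Lemma totS2 (P : int -> int -> Prop) :
  (forall p q, P p (q + 1)) -> forall p q, P p q.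
Proof. by move=> h p q; rewrite -(subrK 1 q). Qed.

Definition dccast A p p' q q' (e : p = p') (e' : q = q') (x : A p q) : A p' q' :=
  match e in _ = i return A i q' with erefl =>
    match e' in _ = j return A p j with erefl => x end end.

Lemma dccast_id A p q (e : p = p) (e' : q = q) (x : A p q) : dccast e e' x = x.
Proof. by rewrite (eq_irrelevance e erefl) (eq_irrelevance e' erefl). Qed.

Lemma dccast_linear A p p' q q' (e : p = p') (e' : q = q') :
  linear (@dccast A p p' q q' e e').
Proof. by case: _ / e; case: _ / e'. Qed.

Definition tin_fun A p q (x : A p q) : tot A := fun p' q' =>
  match p =P p', q =P q' with
  | ReflectT e, ReflectT e' => dccast e e' x
  | _, _ => 0
  end.

Lemma tin_linear A p q : linear (@tin_fun A p q).
Proof.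
move=> a x y; apply: tot_ext => p' q'.
rewrite -[RHS]/(a *: tin_fun x p' q' + tin_fun y p' q') /tin_fun.
case: eqP => [e|_]; last by rewrite scaler0 addr0.
case: eqP => [e'|_]; last by rewrite scaler0 addr0.
exact: dccast_linear.
Qed.

Definition tin A p q : {linear A p q -> tot A} := linear_of (@tin_linear A p q).

Lemma tin_id A p q (x : A p q) : tin A p q x p q = x.
Proof.
rewrite /= /tin_fun; case: eqP => // e; case: eqP => // e'.
by rewrite dccast_id.
Qed.

Lemma tin_ne A p q (x : A p q) p' q' : (p, q) != (p', q') -> tin A p q x p' q' = 0.
Proof. by rewrite /= /tin_fun xpair_eqE; case: eqP => // e; case: eqP. Qed.

Definition tev A p q : tot A -> A p q := fun x => x p q.
Lemma tev_linear A p q : linear (@tev A p q).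
Proof. by []. Qed.
HB.instance Definition _ A p q :=
  GRing.isLinear.Build K (tot A) (A p q) _ (@tev A p q) (@tev_linear A p q).

Definition td1_fun A (x : tot A) : tot A := fun p q =>
  dccast (subrK 1 p) erefl (d1 A (p - 1) q (x (p - 1) q)).
Definition td2_fun A (x : tot A) : tot A := fun p q =>
  dccast erefl (subrK 1 q) (d2 A p (q - 1) (x p (q - 1))).

Lemma tot_glue1 A (z : forall p q, A (p + 1) q) :
  exists x : tot A, forall p q, x (p + 1) q = z p q.
Proof.
exists (fun p q => dccast (subrK 1 p) erefl (z (p - 1) q)) => p q.
move: (subrK 1 (p + 1)); have -> : p + 1 - 1 = p by rewrite addrK.
by move=> e; rewrite dccast_id.
Qed.
Lemma tot_glue2 A (z : forall p q, A p (q + 1)) :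
  exists x : tot A, forall p q, x p (q + 1) = z p q.
Proof.
exists (fun p q => dccast erefl (subrK 1 q) (z p (q - 1))) => p q.
move: (subrK 1 (q + 1)); have -> : q + 1 - 1 = q by rewrite addrK.
by move=> e; rewrite dccast_id.
Qed.

Lemma td1_linear A : linear (@td1_fun A).
Proof.
move=> a x y; apply: tot_ext => p q.
rewrite -[RHS]/(a *: td1_fun x p q + td1_fun y p q) /td1_fun -dccast_linear.
by rewrite -(linearP (d1 A (p - 1) q)).
Qed.
Lemma td2_linear A : linear (@td2_fun A).
Proof.
move=> a x y; apply: tot_ext => p q.
rewrite -[RHS]/(a *: td2_fun x p q + td2_fun y p q) /td2_fun -dccast_linear.
by rewrite -(linearP (d2 A p (q - 1))).
Qed.
Definition td1 A : {linear tot A -> tot A} := linear_of (@td1_linear A).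
Definition td2 A : {linear tot A -> tot A} := linear_of (@td2_linear A).

Lemma td1E A (x : tot A) p q : td1 A x (p + 1) q = d1 A p q (x p q).
Proof.
rewrite /= /td1_fun; move: (subrK 1 (p + 1)).
have -> : p + 1 - 1 = p by rewrite addrK.
by move=> e; rewrite dccast_id.
Qed.
Lemma td2E A (x : tot A) p q : td2 A x p (q + 1) = d2 A p q (x p q).
Proof.
rewrite /= /td2_fun; move: (subrK 1 (q + 1)).
have -> : q + 1 - 1 = q by rewrite addrK.
by move=> e; rewrite dccast_id.
Qed.

Lemma td11 A (x : tot A) : td1 A (td1 A x) = 0.
Proof.
apply: tot_ext; apply: totS1 => p q; rewrite td1E; move: p q.
by apply: totS1 => p q; rewrite td1E d1d1.
Qed.
Lemma td22 A (x : tot A) : td2 A (td2 A x) = 0.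
Proof.
apply: tot_ext; apply: totS2 => p q; rewrite td2E; move: p q.
by apply: totS2 => p q; rewrite td2E d2d2.
Qed.
Lemma td12 A (x : tot A) : td2 A (td1 A x) = - td1 A (td2 A x).
Proof.
apply: tot_ext; apply: totS1; apply: totS2 => p q.
rewrite -[RHS]/(- (td1 A (td2 A x) (p + 1) (q + 1))) td1E td2E td2E td1E.
by apply/esym/eqP; rewrite eqr_oppLR -addr_eq0 d1d2.
Qed.

Lemma td1_tin A p q (x : A p q) : td1 A (tin A p q x) = tin A (p + 1) q (d1 A p q x).
Proof.
apply: tot_ext; apply: totS1 => p' q'; rewrite td1E.
have [[<- <-]|ne] := eqVneq (p, q) (p', q'); first by rewrite !tin_id.
by rewrite !tin_ne ?linear0 // xpair_eqE (inj_eq (addIr _)) -xpair_eqE.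
Qed.
Lemma td2_tin A p q (x : A p q) : td2 A (tin A p q x) = tin A p (q + 1) (d2 A p q x).
Proof.
apply: tot_ext; apply: totS2 => p' q'; rewrite td2E.
have [[<- <-]|ne] := eqVneq (p, q) (p', q'); first by rewrite !tin_id.
by rewrite !tin_ne ?linear0 // xpair_eqE (inj_eq (addIr _)) -xpair_eqE.
Qed.

Definition tmap_fun A B (f : dhom A B) (x : tot A) : tot B := fun p q => f p q (x p q).
Lemma tmap_linear A B (f : dhom A B) : linear (tmap_fun f).
Proof. by move=> a x y; apply: tot_ext => p q; exact: linearP. Qed.
Definition tmap A B (f : dhom A B) : {linear tot A -> tot B} :=
  linear_of (tmap_linear f).

Lemma tmapE A B (f : dhom A B) x p q : tmap f x p q = f p q (x p q).
Proof. by []. Qed.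

Lemma tmap_td1 A B (f : dhom A B) x : tmap f (td1 A x) = td1 B (tmap f x).
Proof.
by apply: tot_ext; apply: totS1 => p q; rewrite td1E !tmapE td1E dhom_d1.
Qed.
Lemma tmap_td2 A B (f : dhom A B) x : tmap f (td2 A x) = td2 B (tmap f x).
Proof.
by apply: tot_ext; apply: totS2 => p q; rewrite td2E !tmapE td2E dhom_d2.
Qed.
Lemma tmap_tin A B (f : dhom A B) p q x : tmap f (tin A p q x) = tin B p q (f p q x).
Proof.
apply: tot_ext => p' q'; rewrite tmapE.
have [[<- <-]|ne] := eqVneq (p, q) (p', q'); first by rewrite !tin_id.
by rewrite !tin_ne ?linear0.
Qed.

Section Degree0.
Variables (A B : dcomplex K) (g : {linear tot A -> tot B}).
Hypothesis (g1 : forall x, g (td1 A x) = td1 B (g x)).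
Hypothesis (g2 : forall x, g (td2 A x) = td2 B (g x)).

(** A linear map between total spaces may mix bidegrees. Its part of bidegree (0, 0) still commutes
    with the differentials, as these are homogeneous. *)
Definition deg0_fun p q : {linear A p q -> B p q} := @tev B p q \o (g \o tin A p q).
Lemma deg0_d1 p q x : deg0_fun (p + 1) q (d1 A p q x) = d1 B p q (deg0_fun p q x).
Proof.
by rewrite -[LHS]/(g (tin A _ _ (d1 A p q x)) _ _) -td1_tin g1 td1E.
Qed.
Lemma deg0_d2 p q x : deg0_fun p (q + 1) (d2 A p q x) = d2 B p q (deg0_fun p q x).
Proof.
by rewrite -[LHS]/(g (tin A _ _ (d2 A p q x)) _ _) -td2_tin g2 td2E.
Qed.
Definition deg0 : dhom A B := DHom deg0_d1 deg0_d2.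
Lemma deg0E p q x : deg0 p q x = g (tin A p q x) p q. Proof. by []. Qed.
End Degree0.

Definition sq A B (h : {linear tot A -> tot B}) : {linear tot A -> tot B} :=
  sqmap (td1 A) (td2 A) (td1 B) (td2 B) h.

Lemma sqE A B (h : {linear tot A -> tot B}) x : sq h x =
  td1 B (td2 B (h x)) + td2 B (h (td1 A x)) - td1 B (h (td2 A x)) + h (td1 A (td2 A x)).
Proof. by []. Qed.
Lemma sq_td1 A B (h : {linear tot A -> tot B}) x : sq h (td1 A x) = td1 B (sq h x).
Proof. apply: sqmap_d1; by [exact: td11|exact: td12]. Qed.
Lemma sq_td2 A B (h : {linear tot A -> tot B}) x : sq h (td2 A x) = td2 B (sq h x).
Proof. apply: sqmap_d2; by [exact: td22|exact: td12]. Qed.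

(** The map [h] need not be homogeneous: the part of bidegree (0, 0) of [sq h] depends only on the
    part of [h] of bidegree (-1, -1). *)
Definition sqhom A B (h : {linear tot A -> tot B}) : dhom A B :=
  deg0 (sq_td1 h) (sq_td2 h).

Lemma sqhomE A B (h : {linear tot A -> tot B}) p q x :
  sqhom h p q x = sq h (tin A p q x) p q.
Proof. by []. Qed.

End TotalSpace.

Arguments tin : simpl never.
Arguments td1 : simpl never.
Arguments td2 : simpl never.
Arguments tmap : simpl never.
Arguments sq : simpl never.

(** * E_1-isomorphisms are invertible up to null maps *)

Lemma inj_surj_bij (X Y : Type) (h : X -> Y) :
  injective h -> (forall y, exists x, h x = y) -> bijective h.
Proof.
move=> hI /choice[g gK]; exists g => // x.
exact/hI/gK.
Qed.

Section SubquotMapTheory.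
Variables (K : fieldType) (V W : lmodType K) (f : {linear V -> W}).
Variables (Z B : submodClosed V) (Z' B' : submodClosed W).
Variables (fZ : {in Z, forall x, f x \in Z'}) (fB : {in B, forall x, f x \in B'}).

Lemma subquot_map_bijP : bijective (subquot_map fZ fB) <->
  (forall x, x \in Z -> f x \in B' -> x \in B) /\
  (forall y, y \in Z' -> exists2 x, x \in Z & f x - y \in B').
Proof.
have piE := @subquot_map_funE _ _ _ f _ _ _ _ fZ fB.
split=> [[g gK Kg]|[fI fS]].
  split=> [x xZ fxB|y yZ].
    have /subquot_piP : subquot_pi B (Submod xZ) = subquot_pi B 0.
      apply: (can_inj gK); rewrite !(piE _ : subquot_map fZ fB _ = _).
      by apply/subquot_piP; rewrite /= -linearB subr0.
    by rewrite /= subr0.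
  have := Kg (subquot_pi B' (Submod yZ)); elim/subquot_ind: (g _) => x.
  rewrite (piE _ : subquot_map fZ fB _ = _) => /subquot_piP /= xy.
  by exists (val x) => //; apply: submod_valP.
apply: inj_surj_bij => [|].
  elim/subquot_ind => x; elim/subquot_ind => y.
  rewrite !(piE _ : subquot_map fZ fB _ = _) => /subquot_piP /=.
  rewrite -(linearB f) => xy; apply/subquot_piP.
  by apply: fI xy; rewrite -scaleN1r rpredD ?rpredZ ?submod_valP.
elim/subquot_ind => y; have [x xZ xy] := fS _ (submod_valP y).
exists (subquot_pi B (Submod xZ)).
by rewrite (piE _ : subquot_map fZ fB _ = _); apply/subquot_piP.
Qed.

End SubquotMapTheory.

Lemma subquot_map_comp_id (K : fieldType) (V W : lmodType K) (f : {linear V -> W})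
  (g : {linear W -> V}) (Z B : submodClosed V) (Z' B' : submodClosed W)
  (fZ : {in Z, forall x, f x \in Z'}) (fB : {in B, forall x, f x \in B'})
  (gZ : {in Z', forall x, g x \in Z}) (gB : {in B', forall x, g x \in B}) :
  (forall x, x \in Z -> g (f x) - x \in B) ->
  cancel (subquot_map fZ fB) (subquot_map gZ gB).
Proof.
move=> gf; elim/subquot_ind => x.
rewrite (subquot_map_funE fZ fB _ : subquot_map fZ fB _ = _).
rewrite (subquot_map_funE gZ gB _ : subquot_map gZ gB _ = _).
by apply/subquot_piP; apply: gf; apply: submod_valP.
Qed.

Section E1.
Variable K : fieldType.
Implicit Types A B : dcomplex K.

(** As [tot] is a product, witnesses chosen in each bidegree form a single element. So bijectivity
    in all bidegrees becomes one statement about total spaces; the converse tests it on the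
    homogeneous elements [tin]. *)
Lemma H_d1_bijP A B (f : dhom A B) : (forall p q, bijective (H_d1_map f p q)) <->
  (forall x y, td1 A x = 0 -> tmap f x = td1 B y -> exists z, x = td1 A z) /\
  (forall y, td1 B y = 0 -> exists x z, td1 A x = 0 /\ y = tmap f x + td1 B z).
Proof.
split=> [bij|[fI fS] p q].
  have {}bij p q := (subquot_map_bijP _ _).1 (bij p q); split.
    move=> x y x0 fxy.
    have Hz p q : exists z, x (p + 1) q = d1 A p q z.
      have [+ _] := bij p q; rewrite /= => /(_ (x (p + 1) q)).
      rewrite !inE -td1E x0 eqxx => /(_ erefl) [|z <-]; last by exists z.
      by exists (y p q); rewrite -td1E -fxy.
    have z p q := cid (Hz p q).
    exists (fun p q => sval (z p q)); apply: tot_ext; apply: totS1 => p q.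
    by rewrite td1E; case: (z p q).
  move=> y y0.
  have Hx p q : exists xz : A (p + 1) q * B p q,
      d1 A (p + 1) q xz.1 = 0 /\ y (p + 1) q = f (p + 1) q xz.1 + d1 B p q xz.2.
    have [_ +] := bij p q; rewrite /= => /(_ (y (p + 1) q)).
    rewrite !inE -td1E y0 eqxx => /(_ erefl) [x]; rewrite !inE => /eqP x0 [z zE].
    by exists (x, - z); split; rewrite //= linearN zE opprB [RHS]addrC subrK.
  have xz p q := cid (Hx p q); have [x xE] := tot_glue1 (fun p q => (sval (xz p q)).1).
  exists x, (fun p q => (sval (xz p q)).2); split; apply: tot_ext; apply: totS1 => p q.
    rewrite td1E; move: p q; apply: totS1 => p q.
    by rewrite xE; case: (xz p q) => [? []].
  rewrite -[RHS]/(tmap f x (p + 1) q + td1 B _ (p + 1) q) tmapE td1E xE.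
  by case: (xz p q) => [? []].
apply/subquot_map_bijP; split=> [x|y]; rewrite !inE.
  move=> /eqP x0 [y yE]; have [||z zE] := fI (tin A _ _ x) (tin B _ _ y).
  - by rewrite td1_tin x0 linear0.
  - by rewrite tmap_tin td1_tin yE.
  - by exists (z p q); rewrite -td1E -zE tin_id.
move=> /eqP y0; have [|x [z [x0 yE]]] := fS (tin B _ _ y).
  by rewrite td1_tin y0 linear0.
exists (x (p + 1) q); rewrite !inE -?td1E ?x0 //.
exists (- z p q); rewrite linearN -td1E -tmapE -{1}(tin_id y) yE.
by rewrite -[tmap f x _ _ - _]/((tmap f x - (tmap f x + td1 B z)) _ _) opprD addNKr.
Qed.

Lemma H_d2_bijP A B (f : dhom A B) : (forall p q, bijective (H_d2_map f p q)) <->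
  (forall x y, td2 A x = 0 -> tmap f x = td2 B y -> exists z, x = td2 A z) /\
  (forall y, td2 B y = 0 -> exists x z, td2 A x = 0 /\ y = tmap f x + td2 B z).
Proof.
split=> [bij|[fI fS] p q].
  have {}bij p q := (subquot_map_bijP _ _).1 (bij p q); split.
    move=> x y x0 fxy.
    have Hz p q : exists z, x p (q + 1) = d2 A p q z.
      have [+ _] := bij p q; rewrite /= => /(_ (x p (q + 1))).
      rewrite !inE -td2E x0 eqxx => /(_ erefl) [|z <-]; last by exists z.
      by exists (y p q); rewrite -td2E -fxy.
    have z p q := cid (Hz p q).
    exists (fun p q => sval (z p q)); apply: tot_ext; apply: totS2 => p q.
    by rewrite td2E; case: (z p q).
  move=> y y0.
  have Hx p q : exists xz : A p (q + 1) * B p q,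
      d2 A p (q + 1) xz.1 = 0 /\ y p (q + 1) = f p (q + 1) xz.1 + d2 B p q xz.2.
    have [_ +] := bij p q; rewrite /= => /(_ (y p (q + 1))).
    rewrite !inE -td2E y0 eqxx => /(_ erefl) [x]; rewrite !inE => /eqP x0 [z zE].
    by exists (x, - z); split; rewrite //= linearN zE opprB [RHS]addrC subrK.
  have xz p q := cid (Hx p q); have [x xE] := tot_glue2 (fun p q => (sval (xz p q)).1).
  exists x, (fun p q => (sval (xz p q)).2); split; apply: tot_ext; apply: totS2 => p q.
    rewrite td2E; move: p q; apply: totS2 => p q.
    by rewrite xE; case: (xz p q) => [? []].
  rewrite -[RHS]/(tmap f x p (q + 1) + td2 B _ p (q + 1)) tmapE td2E xE.
  by case: (xz p q) => [? []].
apply/subquot_map_bijP; split=> [x|y]; rewrite !inE.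
  move=> /eqP x0 [y yE]; have [||z zE] := fI (tin A _ _ x) (tin B _ _ y).
  - by rewrite td2_tin x0 linear0.
  - by rewrite tmap_tin td2_tin yE.
  - by exists (z p q); rewrite -td2E -zE tin_id.
move=> /eqP y0; have [|x [z [x0 yE]]] := fS (tin B _ _ y).
  by rewrite td2_tin y0 linear0.
exists (x p (q + 1)); rewrite !inE -?td2E ?x0 //.
exists (- z p q); rewrite linearN -td2E -tmapE -{1}(tin_id y) yE.
by rewrite -[tmap f x _ _ - _]/((tmap f x - (tmap f x + td2 B z)) _ _) opprD addNKr.
Qed.

End E1.

(** * The socle condition for E_1-isomorphisms of bounded complexes *)

Section StableInverseE1.
Variable K : fieldType.
Implicit Types A B : dcomplex K.

Definition column_fun A (n : int) (x : tot A) : tot A :=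
  fun p q => if p == n then x p q else 0.
Lemma column_linear A n : linear (@column_fun A n).
Proof.
move=> a x y; apply: tot_ext => p q.
rewrite -[RHS]/(a *: column_fun n x p q + column_fun n y p q) /column_fun.
by case: eqP => // _; rewrite scaler0 addr0.
Qed.
Definition column A n : {linear tot A -> tot A} := linear_of (@column_linear A n).

Lemma columnE A n (x : tot A) p q : column A n x p q = if p == n then x p q else 0.
Proof. by []. Qed.

Lemma column_td1 A n (x : tot A) : column A (n + 1) (td1 A x) = td1 A (column A n x).
Proof.
apply: tot_ext; apply: totS1 => p q; rewrite columnE !td1E columnE.
by rewrite (inj_eq (addIr 1)); case: eqP => // _; rewrite linear0.
Qed.
Lemma column_td2 A n (x : tot A) : column A n (td2 A x) = td2 A (column A n x).
Proof.
apply: tot_ext; apply: totS2 => p q; rewrite columnE !td2E columnE.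
by case: eqP => // _; rewrite linear0.
Qed.
Lemma column_tmap A B (f : dhom A B) n x :
  column B n (tmap f x) = tmap f (column A n x).
Proof.
apply: tot_ext => p q; rewrite columnE !tmapE columnE.
by case: eqP => // _; rewrite linear0.
Qed.
Lemma column_id A n (x : tot A) : column A n (column A n x) = column A n x.
Proof. by apply: tot_ext => p q; rewrite !columnE; case: eqP. Qed.

Lemma bounded_below A : bounded A -> exists N, forall p q (x : A p q), p <= N -> x = 0.
Proof.
(* The sum of the absolute values of all first degrees in the support bounds each of them. *)
move=> /finite_seqP[s sE]; pose M := (\sum_(z <- s) absz z.1)%N.
exists (- M%:Z - 1) => p q x pN; apply: contrapT => x0.
have ps : (p, q) \in s by have : [set` s] (p, q) by rewrite -sE; exists x.
have : (absz p <= M)%N by rewrite /M (big_rem _ ps) /= leq_addr.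
lia.
Qed.

(* Induction on the column: write a = d1 y with f y = d2 b + d1 c, and apply the
   induction hypothesis to d2 y and - c. *)
Lemma E1_socle_column A B (f : dhom A B) N :
  (forall p q (x : A p q), p <= N -> x = 0) ->
  (forall p q (x : B p q), p <= N -> x = 0) -> E1_isomorphism f ->
  forall (m : nat) n (a : tot A) (b : tot B), n <= N + m%:Z ->
    column A (n + 1) a = a -> column B n b = b ->
    td1 A a = 0 -> td2 A a = 0 -> tmap f a = td1 B (td2 B b) ->
  exists w u v, a = td1 A (td2 A w) /\ tmap f w - b = td1 B u + td2 B v.
Proof.
move=> A0 B0 [/H_d1_bijP[inj1 surj1] /H_d2_bijP[inj2 surj2]].
elim=> [|m IH] n a b nN ca cb a1 a2 fa.
  (* Both [b] and the preimage of [a] live in column [n <= N], where the complexes vanish. So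
     [a = 0], although its own column [n + 1] may be nonzero. *)
  have b0 : b = 0.
    apply: tot_ext => p q; rewrite -cb columnE; case: eqP => // pn.
    by apply: B0; rewrite pn; lia.
  rewrite b0 !linear0 in fa; have [|y0 aE] := inj1 a 0 a1; first by rewrite fa linear0.
  exists 0, 0, 0; rewrite b0 !linear0 !addr0; split=> //.
  rewrite -ca aE column_td1 (_ : column A n y0 = 0) ?linear0 //.
  apply: tot_ext => p q; rewrite columnE; case: eqP => // pn.
  by apply: A0; rewrite pn; lia.
have [y0 aE] := inj1 _ _ a1 fa; pose y1 := column A n y0.
have y1E : td1 A y1 = a by rewrite -column_td1 -aE.
(* The difference is a [d1]-cycle, since both terms have the same [d1]. Subtracting the cycle [z0]
   from [y1] turns the difference into a boundary [d1 c]. *)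
have [|z0 [c0 [z01 fyE]]] := surj1 (tmap f y1 - td2 B b).
  by rewrite linearB -tmap_td1 y1E fa subrr.
pose y := y1 - column A n z0; pose c := column B (n - 1) c0.
have yE : td1 A y = a by rewrite linearB y1E -column_td1 z01 linear0 subr0.
have ctd1 x : column B n (td1 B x) = td1 B (column B (n - 1) x).
  by rewrite -column_td1 subrK.
have fy : tmap f y = td2 B b + td1 B c.
  have := congr1 (column B n) fyE; rewrite linearB linearD !column_tmap.
  rewrite !column_id column_td2 cb ctd1 => /eqP.
  rewrite subr_eq => /eqP e; rewrite linearB e -/c addrAC.
  by rewrite [_ + td1 B c]addrC addrK addrC.
(* The element [d2 y] lies one column to the left of [a], and its image is
   [d2 d1 c = d1 d2 (- c)]. *)
have [|||||| y' [u [v [y'E fy']]]] := IH (n - 1) (td2 A y) (- c).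
- by lia.
- by rewrite subrK column_td2 linearB !column_id.
- by rewrite linearN column_id.
- by have := td12 y; rewrite yE a2 => /esym/eqP; rewrite oppr_eq0 => /eqP.
- exact: td22.
- by rewrite tmap_td2 fy linearD td22 add0r td12 !linearN.
(* The correction keeps [d1 s = a], makes [s] a [d2]-cycle and makes its image a [d2]-boundary, so
   that [inj2] applies. *)
pose s := y + td1 A y'.
have s2 : td2 A s = 0 by rewrite linearD td12 y'E subrr.
have fs : tmap f s = td2 B (b - td1 B v).
  rewrite opprK addrC in fy'; rewrite linearD tmap_td1 fy -addrA -linearD fy'.
  by rewrite linearD td11 add0r (linearB (td2 B)) td12 opprK.
have [w0 w0E] := inj2 _ _ s2 fs.
(* The choice of [w0] is free up to [d2]-cycles; this freedom is used to bring [f w - b] into the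
   required form. *)
have [|z [e [z2 fwE]]] := surj2 (tmap f w0 - b + td1 B v).
  rewrite linearD linearB -tmap_td2 -w0E fs (linearB (td2 B)).
  by rewrite [_ - _ - _]addrAC subrr add0r addNr.
exists (w0 - z), (- v), e; split.
  by rewrite (linearB (td2 A)) z2 subr0 -w0E linearD td11 addr0 yE.
rewrite linearB linearN [RHS]addrC addrAC; apply/eqP.
by rewrite subr_eq addrAC -subr_eq opprK; apply/eqP; rewrite fwE addrC.
Qed.

(** The differentials are homogeneous in the first degree, so the claim is proved for each column of
    [b] and the solutions are assembled. *)
Lemma E1_socle A B (f : dhom A B) (a : tot A) (b : tot B) :
  bounded A -> bounded B -> E1_isomorphism f ->
  td1 A a = 0 -> td2 A a = 0 -> tmap f a = td1 B (td2 B b) ->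
  exists a' u v, a = td1 A (td2 A a') /\ tmap f a' - b = td1 B u + td2 B v.
Proof.
move=> /bounded_below[NA A0] /bounded_below[NB B0] fE1 a1 a2 fa.
pose N := Num.min NA NB.
have H n : exists wuv : tot A * tot B * tot B,
    column A (n + 1) a = td1 A (td2 A wuv.1.1) /\
    tmap f wuv.1.1 - column B n b = td1 B wuv.1.2 + td2 B wuv.2.
  have [||||||||w [u [v ?]]] := @E1_socle_column A B f N _ _ fE1 `|n - N|%N n
    (column A (n + 1) a) (column B n b).
  - by move=> p q x pN; apply: A0; rewrite /N in pN; lia.
  - by move=> p q x pN; apply: B0; rewrite /N in pN; lia.
  - by lia.
  - by rewrite column_id.
  - by rewrite column_id.
  - by have := column_td1 (n + 1) a; rewrite a1 linear0.
  - by rewrite -column_td2 a2 linear0.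
  - by rewrite -column_tmap fa column_td1 column_td2.
  - by exists (w, u, v).
have [g gE] := choice H.
(* The first differential raises the column, so column [p] of [u] is taken from the solution for
   column [p + 1] of [b], and that of the other two from the solution for column [p]. *)
exists (fun p q => (g p).1.1 p q), (fun p q => (g (p + 1)).1.2 p q),
  (fun p q => (g p).2 p q); split.
  apply: tot_ext; apply: totS1; apply: totS2 => p q; rewrite td1E td2E -td2E -td1E.
  by have [<- _] := gE p; rewrite columnE eqxx.
apply: tot_ext; apply: totS1; apply: totS2 => p q.
have [_ e0] := gE (p + 1).
have e : f _ _ ((g (p + 1)).1.1 (p + 1) (q + 1)) -
    column B (p + 1) b (p + 1) (q + 1) =
    td1 B (g (p + 1)).1.2 (p + 1) (q + 1) + td2 B (g (p + 1)).2 (p + 1) (q + 1).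
  exact: (congr1 (fun x : tot B => x (p + 1) (q + 1)) e0).
rewrite columnE eqxx in e; rewrite -[LHS]/(f _ _ _ - _) e.
by rewrite -[RHS]/(td1 B _ _ _ + td2 B _ _ _) !td1E !td2E.
Qed.

End StableInverseE1.

(** * Null maps on cohomology, and inverses up to null maps *)

Section HomotopyInverse.
Variable K : fieldType.
Implicit Types A B : dcomplex K.

(** This formula and the next two show why null maps induce 0 on [H_A], [H_d1] and [H_d2]: on the
    relevant cycles all remaining terms are boundaries. *)
Lemma sq_ker12 A B (k : {linear tot A -> tot B}) t : td1 A (td2 A t) = 0 ->
  sq k t = td1 B (td2 B (k t) - k (td2 A t)) + td2 B (k (td1 A t)).
Proof. by move=> t12; rewrite sqE t12 linear0 addr0 linearB addrAC. Qed.

Lemma sq_ker1 A B (k : {linear tot A -> tot B}) t : td1 A t = 0 ->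
  sq k t = td1 B (td2 B (k t) - k (td2 A t)).
Proof.
move=> t1; rewrite sq_ker12 ?t1 ?linear0 ?addr0 //.
by apply/eqP; rewrite -oppr_eq0 -td12 t1 linear0.
Qed.

Lemma sq_ker2 A B (k : {linear tot A -> tot B}) t : td2 A t = 0 ->
  sq k t = td2 B (k (td1 A t) - td1 B (k t)).
Proof.
move=> t2; rewrite sq_ker12 t2 ?(linear0 (td1 A)) // (linear0 k) subr0.
by rewrite linearB td12 opprK addrC.
Qed.

(** With this, inverses up to null maps on one side suffice: [g] inverts [f] on the left, and [g],
    again an E_1-isomorphism, has a left inverse too. *)
Lemma bijective_of_sections (X Y : Type) (h : X -> Y) (h' : Y -> X) (h'' : X -> Y) :
  cancel h h' -> cancel h' h'' -> bijective h.
Proof.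
move=> hK h'K; exists h' => // y.
by apply: (can_inj h'K); rewrite hK.
Qed.

Section Fixed.
Variables (A B : dcomplex K) (f : dhom A B) (g : dhom B A).
Variable k : {linear tot A -> tot A}.
Hypothesis gf : forall p q x, g p q (f p q x) = x - sqhom k p q x.

Let gfB p q x : g p q (f p q x) - x = - sqhom k p q x.
Proof. by rewrite gf addrAC subrr add0r. Qed.

Lemma H_d1_can p q : cancel (H_d1_map f p q) (H_d1_map g p q).
Proof.
apply: subquot_map_comp_id => x; rewrite inE => /eqP x1.
rewrite gfB rpredN inE; set t := tin A _ _ x.
exists ((td2 A (k t) - k (td2 A t)) p q).
by rewrite -td1E -sq_ker1 // td1_tin x1 linear0.
Qed.

Lemma H_d2_can p q : cancel (H_d2_map f p q) (H_d2_map g p q).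
Proof.
apply: subquot_map_comp_id => x; rewrite inE => /eqP x2.
rewrite gfB rpredN inE; set t := tin A _ _ x.
exists ((k (td1 A t) - td1 A (k t)) p q).
by rewrite -td2E -sq_ker2 // td2_tin x2 linear0.
Qed.

Lemma H_BC_can p q : cancel (H_BC_map f p q) (H_BC_map g p q).
Proof.
apply: subquot_map_comp_id => x; rewrite inE => /andP[/eqP x1 /eqP x2].
rewrite gfB rpredN inE; exists ((k (tin A _ _ x)) p q).
rewrite -[LHS]/(d1 A _ _ (d2 A _ _ _)) -td2E -td1E sqhomE.
rewrite sq_ker1 ?td1_tin ?x1 ?linear0 //.
by rewrite td2_tin x2 (linear0 (tin A _ _)) (linear0 k) subr0.
Qed.

Lemma H_A_can p q : cancel (H_A_map f p q) (H_A_map g p q).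
Proof.
apply: subquot_map_comp_id => x; rewrite inE => /eqP x12.
rewrite gfB rpredN inE; set t := tin A _ _ x.
exists (td1 A (td2 A (k t) - k (td2 A t)) (p + 1) (q + 1)),
  (td2 A (k (td1 A t)) (p + 1) (q + 1)).
split; first by rewrite inE td1E; eexists.
  by rewrite inE td2E; eexists.
by rewrite sqhomE sq_ker12 // td2_tin td1_tin -[d1 A _ _ _]/(d1_d2 A _ _ x) x12 linear0.
Qed.

End Fixed.

(** [E1_socle] is the hypothesis of [stable_inverse]. The resulting [g] is an E_1-isomorphism
    because null maps vanish on the first pages, where [g] is therefore a left inverse of a
    bijection. *)
Lemma E1_homotopy_inverse A B (f : dhom A B) :
  bounded A -> bounded B -> E1_isomorphism f ->
  exists (g : dhom B A) (k : {linear tot A -> tot A}),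
    E1_isomorphism g /\ forall p q x, g p q (f p q x) = x - sqhom k p q x.
Proof.
move=> bA bB fE1.
have [g [k [g1 g2 gf]]] := stable_inverse (@td11 K A) (@td22 K A) (@td12 K A)
  (@td11 K B) (@td22 K B) (@td12 K B) (tmap_td1 f) (tmap_td2 f)
  (fun a b => @E1_socle K A B f a b bA bB fE1).
have gE p q x : deg0 g1 g2 p q (f p q x) = x - sqhom k p q x.
  rewrite deg0E -tmap_tin gf sqhomE -[LHS]/(tin A p q x p q - sq k (tin A p q x) p q).
  by rewrite tin_id.
exists (deg0 g1 g2), k; split=> //; case: fE1 => f1 f2.
split=> p q; [apply: (bij_can_bij (f1 p q)); exact: (H_d1_can gE)|].
by apply: (bij_can_bij (f2 p q)); exact: (H_d2_can gE).
Qed.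

End HomotopyInverse.

(** * Linear functors *)

Section DirectSumTheory.
Variables (K : fieldType) (I : Type) (V : I -> lmodType K).
Implicit Types x y : dsum V.

Lemma dsum_ext x y : (forall i, val x i = val y i) -> x = y.
Proof. by move=> xy; apply: val_inj; apply: functional_extensionality_dep. Qed.

(** The alias [{classic I}] carries a decidable equality, so that finite supports can be listed and
    summed over. *)
Lemma dsum_suppP x : exists2 s : seq {classic I}, uniq s &
  forall i : {classic I}, i \notin s -> val x i = 0.
Proof.
have [s sE] := (@finite_seqP {classic I} [set i | val x i <> 0]).1
  (elimT (asboolP _) (submod_valP x)).
exists (undup s) => [|i]; first exact: undup_uniq.
rewrite mem_undup => si; apply: contrapT => xi; move/negP: si; apply.
by have : [set` s] i by rewrite -sE.
Qed.

Definition dsingle_coord i (v : V i) : dprod V := fun j =>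
  match pselect (i = j) with
  | left e => match e in _ = j return V j with erefl => v end
  | right _ => 0
  end.

Lemma dsingle_finsupp i (v : V i) : dsingle_coord v \in @finsupp K I V.
Proof.
rewrite inE; apply: (@sub_finite_set _ _ [set i]); last exact: finite_set1.
by move=> j; rewrite /= /dsingle_coord; case: pselect.
Qed.

Definition dsingle_fun i (v : V i) : dsum V := Submod (dsingle_finsupp v).

Lemma dsingle_linear i : linear (@dsingle_fun i).
Proof.
move=> a v w; apply: dsum_ext => j.
rewrite -[RHS]/(a *: dsingle_coord v j + dsingle_coord w j) /= /dsingle_coord.
by case: pselect => [e|_]; [case: _ / e|rewrite scaler0 addr0].
Qed.

Definition dsingle i : {linear V i -> dsum V} := linear_of (@dsingle_linear i).

Lemma dsingle_id i (v : V i) : val (dsingle i v) i = v.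
Proof.
rewrite /= /dsingle_coord; case: pselect => // e.
by rewrite (Prop_irrelevance e erefl).
Qed.

Lemma dsingle_ne i j (v : V i) : i <> j -> val (dsingle i v) j = 0.
Proof. by rewrite /= /dsingle_coord; case: pselect. Qed.

Lemma dsum_ind (P : dsum V -> Prop) : P 0 -> (forall x y, P x -> P y -> P (x + y)) ->
  (forall i v, P (dsingle i v)) -> forall x, P x.
Proof.
move=> P0 PD P1 x; have [s _] := dsum_suppP x.
elim: s x => [|i s IH] x xs.
  by rewrite (_ : x = 0) //; apply: dsum_ext => i; apply: xs.
rewrite -[x](subrK (dsingle i (val x i))); apply: PD => //; apply: IH => j js.
rewrite -[LHS]/(val x j - val (dsingle i (val x i)) j).
have [<-|ij] := pselect (i = j); first by rewrite dsingle_id subrr.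
rewrite dsingle_ne // xs ?subr0 // inE negb_or js andbT.
by apply/eqP => ji; apply: ij.
Qed.

Lemma dsum_lift (W : lmodType K) (f : forall i, {linear V i -> W}) :
  exists F : {linear dsum V -> W}, forall i v, F (dsingle i v) = f i v.
Proof.
pose F x : W := \sum_(i \in [set: {classic I}]) f i (val x i).
have FE s x : uniq s -> (forall i : {classic I}, i \notin s -> val x i = 0) ->
    F x = \sum_(i <- s) f i (val x i).
  move=> us xs; rewrite /F (fsbigE s) //=; last by move=> i _ /xs ->; rewrite linear0.
  by apply: eq_bigl => i; exact: in_setT.
have lF : linear F.
  move=> a x y; have [sx ux xs] := dsum_suppP x; have [sy uy ys] := dsum_suppP y.
  pose s := undup (sx ++ sy); have us : uniq s by exact: undup_uniq.
  have sE i : i \notin s -> val x i = 0 /\ val y i = 0.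
    by rewrite mem_undup mem_cat negb_or => /andP[/xs -> /ys ->].
  rewrite !(FE s) // => [|i /sE[]//|i /sE[]//|i /sE[x0 y0]]; last first.
    by rewrite -[LHS]/(a *: val x i + val y i) x0 y0 scaler0 addr0.
  rewrite scaler_sumr -big_split; apply: eq_bigr => i _.
  exact: linearP.
exists (linear_of lF) => i v /=; rewrite (FE [:: (i : {classic I})]) //.
  by rewrite big_seq1 dsingle_id.
by move=> j; rewrite inE => /eqP ij; rewrite dsingle_ne // => /esym.
Qed.

End DirectSumTheory.

(** * Factoring null morphisms through squares *)

Section Functor.
Variable K : fieldType.

Lemma linear_ext (U V : lmodType K) (f g : {linear U -> V}) : f =1 g -> f = g.
Proof.
move=> fg; have : (f : U -> V) = g by apply: funext.
case: f {fg} => f [[f1] [f2]]; case: g => g [[g1] [g2]] /= fg.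
subst g; congr GRing.Linear.Pack.
by rewrite (Prop_irrelevance f1 g1) (Prop_irrelevance f2 g2).
Qed.

(** A functor acts on morphisms as terms, so pointwise equal morphisms have to be equal before its
    laws can be applied. *)
Lemma dhom_ext (A B : dcomplex K) (f g : dhom A B) :
  (forall p q x, f p q x = g p q x) -> f = g.
Proof.
case: f g => [f f1 f2] [g g1 g2] /= fg.
have {}fg : f = g.
  apply: functional_extensionality_dep => p; apply: functional_extensionality_dep => q.
  by apply: linear_ext => x; apply: fg.
subst g; by rewrite (Prop_irrelevance f1 g1) (Prop_irrelevance f2 g2).
Qed.

Implicit Types A B X : dcomplex K.

Lemma sqhom_add A B (k k1 k2 : {linear tot A -> tot B}) :
  (forall x, k x = k1 x + k2 x) -> sqhom k = dhom_lin 1 (sqhom k1) (sqhom k2).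
Proof.
move=> kE; have sqk t : sq k t = sq k1 t + sq k2 t.
  rewrite !sqE !kE !linearD !addrA.
  by rewrite [LHS](ACl (1*3*5*7*2*4*6*8))%AC.
apply: dhom_ext => p q x.
by rewrite -[RHS]/(1 *: (sqhom k1 p q x) + sqhom k2 p q x) scale1r !sqhomE sqk.
Qed.

(* X is to be a sum of squares with top right corner in (p + 1, q + 1). *)
Lemma sqhom_factor A X p q (s0 : {linear X (p + 1) (q + 1) -> X p q})
    (th : {linear A (p + 1) (q + 1) -> X (p + 1) (q + 1)})
    (m0 : {linear X (p + 1) (q + 1) -> tot A}) :
  (forall y, d1_d2 X p q (s0 y) = y) ->
  exists (u : dhom A X) (v : dhom X A),
    sqhom (m0 \o (th \o @tev K A (p + 1) (q + 1))) = dhom_comp v u.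
Proof.
(* [L] maps the top right corner of the squares to their bottom left corner, and [M] starts from the
   top right corner. *)
move=> s0K; pose L : {linear tot A -> tot X} :=
  tin X p q \o (s0 \o (th \o @tev K A (p + 1) (q + 1))).
pose M : {linear tot X -> tot A} := m0 \o @tev K X (p + 1) (q + 1).
set N := (X in sqhom X); exists (sqhom L), (sqhom M).
have NE t : N t = m0 (th (t (p + 1) (q + 1))) by [].
have ME t : M t = m0 (t (p + 1) (q + 1)) by [].
have LE t : L t = tin X p q (s0 (th (t (p + 1) (q + 1)))) by [].
have neS (a : int) b c : (a + 1 + 1, b) != (a + 1, c) by rewrite xpair_eqE; lia.
have neS' (a : int) b c : (b, a + 1 + 1) != (c, a + 1) by rewrite xpair_eqE; lia.
(* [M] sees only the top right corner. There three of the four terms of [sq L] vanish for degree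
   reasons, and the remaining one is [th] by [s0K]. Since [sqhom L] is a chain map, the composite is
   the null map of [N]. *)
have key a b x : M (tin X a b (sqhom L a b x)) = N (tin A a b x).
  rewrite ME NE; congr (m0 _).
  have [e|ne] := eqVneq (a, b) (p + 1, q + 1); last by rewrite !tin_ne ?linear0.
  have [ea eb] : a = p + 1 /\ b = q + 1 by case: e.
  subst a b; rewrite !tin_id sqhomE sqE !LE !(@td2_tin _ A) !(@td1_tin _ A).
  rewrite tin_id !tin_ne // !linear0 td2_tin td1_tin !addr0 tin_id.
  exact: s0K.
apply: dhom_ext => a b x.
rewrite -[RHS]/(sq M (tin X a b (sqhom L a b x)) a b) sqhomE.
suff -> : sq N (tin A a b x) = sq M (tin X a b (sqhom L a b x)) by [].
by rewrite !sqE !td2_tin !td1_tin -!dhom_d2 -!dhom_d1 !key.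
Qed.

Variables (F : linear_functor K) (A : bdcomplex K).
Implicit Types k : {linear tot A -> tot A}.

Lemma lf_sqhom_sum (J : Type) (s : seq J) (kf : J -> {linear tot A -> tot A}) k :
  (forall x, k x = \sum_(i <- s) kf i x) ->
  (forall i v, lf_map F (sqhom (kf i) : dhom A A) v = 0) ->
  forall v, lf_map F (sqhom k : dhom A A) v = 0.
Proof.
move=> + kf0; elim: s k => [|i s IH] k kE v.
  (* An empty sum gives the zero morphism [z], which is killed since [z = (-1) z + z]. *)
  rewrite (_ : sqhom k = dhom_lin (-1) (sqhom k) (sqhom k)) ?lf_lin ?scaleN1r ?addNr //.
  apply: dhom_ext => p q x; rewrite -[RHS]/((-1) *: _ + _) scaleN1r addNr.
  by rewrite sqhomE sqE !kE !big_nil !linear0 !addr0.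
have kiE x : (k \- kf i) x = \sum_(j <- s) kf j x.
  by rewrite /= kE big_cons addrAC subrr add0r.
rewrite (@sqhom_add _ _ k (kf i) (k \- kf i)); last first.
  by move=> x /=; rewrite addrC subrK.
by rewrite lf_lin kf0 (IH _ kiE) scaler0 addr0.
Qed.

Lemma lf_factor0 (X : bdcomplex K) (f : dhom A A) (u : dhom A X) (v : dhom X A) :
  vanishes F X -> f = dhom_comp v u -> forall x, lf_map F f x = 0.
Proof. by move=> FX -> x; rewrite lf_comp /= [lf_map F u x]FX linear0. Qed.

End Functor.

(** * Vanishing of linear functors on null morphisms *)

Section VanishingOnNull.
Variable K : fieldType.

(** The coordinate on a space of dimension [b], at most 1. The product with a column of ones yields
    0 for [b = false] without a case distinction. *)
Definition rcoord (b : bool) (x : 'rV[K]_b) : K := (x *m (const_mx 1 : 'cV_b)) 0 0.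

Lemma rcoord_linear b : scalar (@rcoord b).
Proof. by move=> a x y; rewrite /rcoord mulmxDl -scalemxAl !mxE. Qed.

Lemma rcoord1 (b : bool) : b -> rcoord (const_mx 1 : 'rV_b) = 1.
Proof. by case: b => // _; rewrite /rcoord mxE big_ord1 !mxE mul1r. Qed.

Lemma rcoordZ1 (b : bool) a : b -> rcoord (a *: const_mx 1 : 'rV_b) = a.
Proof.
move=> bT; rewrite -[_ *: _]addr0 rcoord_linear rcoord1 // mulr1.
by rewrite /rcoord mul0mx mxE addr0.
Qed.

Lemma rcoordK (b : bool) (x : 'rV[K]_b) : rcoord x *: const_mx 1 = x.
Proof.
case: b x => x; last by apply/rowP => -[].
by apply/rowP => j; rewrite /rcoord !mxE big_ord1 !mxE !mulr1 (ord1 j).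
Qed.

Lemma square_section p q : exists
  s : {linear shapeC K (Square (p + 1) (q + 1)) (p + 1) (q + 1) ->
       shapeC K (Square (p + 1) (q + 1)) p q},
  forall y, d1_d2 (shapeC K (Square (p + 1) (q + 1))) p q (s y) = y.
Proof.
set S := Square _ _; have [s sK] := pseudo_inverse (d1_d2 (shapeC K S) p q).
exists s => y; have [x <-] : exists x, d1_d2 (shapeC K S) p q x = y; last exact: sK.
have [|| g1 _ g1K] := @C_d1_bij K S p (q + 1); try by rewrite in_points /=; lia.
have [|| g2 _ g2K] := @C_d2_bij K S p q; try by rewrite in_points /=; lia.
by exists (g2 (g1 y)); rewrite -[LHS]/(d1 _ _ _ (d2 _ _ _ _)) g2K g1K.
Qed.

Lemma shapeC_mem S p q (x : shapeC K S p q) : x <> 0 -> (p, q) \in points S.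
Proof.
by move: x; rewrite /= /C_grade; case: (_ \in _) => // x []; apply/rowP => -[].
Qed.

Lemma bounded_square p q : bounded (shapeC K (Square p q)).
Proof.
apply: (@sub_finite_set _ _ (points (Square p q))) => [[a b] [x /shapeC_mem]|].
  by rewrite inE.
by rewrite /= !finite_setU; do !split; exact: finite_set1.
Qed.

Lemma bounded_squares (I : Type) p q :
  bounded (dcsum (fun _ : I => shapeC K (Square p q))).
Proof.
apply: sub_finite_set (bounded_square p q) => -[a b] [x /= x0].
apply: contrapT => nx; apply: x0; apply: dsum_ext => i; apply: contrapT => xi.
by apply: nx; exists (val x i).
Qed.

Lemma isomorphic_refl (A : dcomplex K) : isomorphic A A.
Proof. by exists (dhom_id A) => p q; exists id. Qed.

Variables (F : linear_functor K) (A : bdcomplex K).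
Hypothesis Fsq : kills_squares F.
Hypothesis FA : kills_square_sums F \/ finite_dim A.

(** A null-homotopy supported in one bidegree factors through squares with their top right corner
    there. Either one large sum of squares is used at once, or the map is split into finitely many
    pieces that need a single square each. *)
Lemma lf_sqhom1 (k : {linear tot A -> tot A}) p q x :
  lf_map F (sqhom (k \o (tin A p q \o @tev K A p q)) : dhom A A) x = 0.
Proof.
rewrite -(subrK 1 p) -(subrK 1 q); move: (p - 1) (q - 1) => {}p {}q.
set S := Square (p + 1) (q + 1); have [s sK] := square_section p q.
have mS : (p + 1, q + 1) \in points S by rewrite in_points /=; lia.
case: FA => [Fsum|fdA].
  (* There is one square for every vector of [A (p + 1) (q + 1)], not just for a basis; this makes
     [e] visibly surjective. *)
  pose I : Type := A (p + 1) (q + 1); pose X := dcsum (fun _ : I => shapeC K S).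
  have lv (v : I) : linear (fun y : shapeC K S (p + 1) (q + 1) => rcoord y *: v).
    by move=> a y z; rewrite rcoord_linear scalerDl scalerA.
  have [e eE] := dsum_lift (fun v : I => linear_of (lv v)).
  have [th thK] := pseudo_inverse e.
  have eth v : e (th v) = v.
    by have := thK (dsingle _ (v : I) (const_mx 1)); rewrite eE /= rcoord1 // scale1r.
  pose sX : {linear X (p + 1) (q + 1) -> X p q} := dsum_map (fun _ => s).
  have [y|u [v uv]] := @sqhom_factor K A X p q sX th (k \o (tin A _ _ \o e)).
    by apply: dsum_ext => i; exact: sK.
  pose bX := BDComplex (@bounded_squares I (p + 1) (q + 1)).
  apply: (@lf_factor0 K F A bX _ u v).
    by apply: (Fsum S I) => //; exact: isomorphic_refl.
  by rewrite -uv; congr sqhom; apply: linear_ext => t /=; rewrite eth.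
(* [F] is only known to vanish on single squares here, so the map is written as a sum of [n] maps of
   rank at most 1, one for each coordinate [th v 0 i]. *)
have [n [e eS]] := fdA (p + 1) (q + 1).
have [th thK] := pseudo_inverse e.
have eth v : e (th v) = v by have [c <-] := eS v; apply: thK.
have lth i : linear (fun v => th v 0 i *: (const_mx 1 : shapeC K S (p + 1) (q + 1))).
  by move=> a v w; rewrite linearP !mxE scalerDl scalerA.
have lm i : linear (fun y : shapeC K S (p + 1) (q + 1) =>
    rcoord y *: k (tin A _ _ (e (delta_mx 0 i)))).
  by move=> a y z; rewrite rcoord_linear scalerDl scalerA.
pose bX := BDComplex (bounded_square (p + 1) (q + 1)).
apply: (@lf_sqhom_sum K F A _ (index_enum 'I_n)
  (fun i => linear_of (lm i) \o (linear_of (lth i) \o @tev K A (p + 1) (q + 1)))).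
  move=> t; pose v : A (p + 1) (q + 1) := t (p + 1) (q + 1).
  have vE : v = \sum_i th v 0 i *: e (delta_mx 0 i).
    rewrite -[LHS]eth [X in e X = _]row_sum_delta linear_sum.
    by apply: eq_bigr => i _; rewrite linearZ.
  transitivity (k (tin A _ _ (\sum_i th v 0 i *: e (delta_mx 0 i)))).
    by rewrite -vE.
  rewrite !linear_sum; apply: eq_bigr => i _; rewrite !linearZ.
  by rewrite -[RHS]/(rcoord (th v 0 i *: const_mx 1) *: _) rcoordZ1.
move=> i v; have [y|u [w uw]] := @sqhom_factor K A (shapeC K S) p q s
  (linear_of (lth i)) (linear_of (lm i)); first exact: sK.
apply: (@lf_factor0 K F A bX _ u w) => //.
by apply: (Fsq (S := S)) => //; exact: isomorphic_refl.
Qed.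

(** Boundedness makes the identity of the total space a finite sum of projections to single
    bidegrees. *)
Lemma lf_sqhom (k : {linear tot A -> tot A}) x : lf_map F (sqhom k : dhom A A) x = 0.
Proof.
have [s sE] := (@finite_seqP _ _).1 (bdc_bounded A).
have As p q (y : A p q) : (p, q) \notin undup s -> y = 0.
  rewrite mem_undup => pqs; apply: contrapT => y0; move/negP: pqs; apply.
  by have : [set` s] (p, q) by rewrite -sE; exists y.
apply: (@lf_sqhom_sum K F A _ (undup s)
  (fun pq => k \o (tin A pq.1 pq.2 \o @tev K A pq.1 pq.2))) => [t|pq];
  last exact: lf_sqhom1.
rewrite -(linear_sum k); congr (k _); apply: tot_ext => p q.
rewrite -[RHS]/(tev p q _) linear_sum.
have [ps|ps] := boolP ((p, q) \in undup s); last first.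
  by rewrite (As _ _ (t p q)) // [RHS](As _ _ _ ps).
rewrite (bigD1_seq _ ps) ?undup_uniq // big1 => [|[p' q'] ne].
  by rewrite [RHS]addr0 -[RHS]/(tin A p q (t p q) p q) tin_id.
by rewrite -[LHS]/(tin A p' q' (t p' q') p q) tin_ne.
Qed.

End VanishingOnNull.

(** The functor sends a composite of the form [1 - sqhom k] to the identity. Finite dimension is
    asked of both complexes because one null-homotopy lives on [A] and the other on [B]. *)
Lemma lf_E1_bijective (K : fieldType) (F : linear_functor K) (A B : bdcomplex K)
  (f : dhom A B) : kills_squares F ->
  kills_square_sums F \/ finite_dim A /\ finite_dim B ->
  E1_isomorphism f -> bijective (lf_map F f).
Proof.
move=> Fsq FAB fE1.
have FA : kills_square_sums F \/ finite_dim A by case: FAB => [|[]]; [left|right].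
have FB : kills_square_sums F \/ finite_dim B by case: FAB => [|[]]; [left|right].
have lf_can (C D : bdcomplex K) (u : dhom C D) (v : dhom D C)
    (k : {linear tot C -> tot C}) :
    kills_square_sums F \/ finite_dim C ->
    (forall p q x, v p q (u p q x) = x - sqhom k p q x) ->
    cancel (lf_map F u) (lf_map F v).
  move=> FC vu x; rewrite -[LHS]/((lf_map F v \o lf_map F u) x) -lf_comp.
  rewrite (_ : dhom_comp v u = dhom_lin (-1) (sqhom k) (dhom_id C)).
    by rewrite lf_lin lf_sqhom // scaler0 add0r lf_id.
  apply: dhom_ext => p q y; rewrite -[LHS]/(v p q (u p q y)) vu.
  by rewrite -[RHS]/(-1 *: _ + y) scaleN1r addrC.
have [g [k [gE1 gf]]] := E1_homotopy_inverse (bdc_bounded A) (bdc_bounded B) fE1.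
have [f' [k' [_ f'g]]] := E1_homotopy_inverse (bdc_bounded B) (bdc_bounded A) gE1.
exact: bijective_of_sections (lf_can _ _ _ _ _ FA gf) (lf_can _ _ _ _ _ FB f'g).
Qed.

(** * Zigzag shapes *)

(** A zigzag is a path ordered by [p - q]: distinct points have distinct values, and a point whose
    value is not minimal has a neighbour with value one less. The next two lemmas complete this
    picture. *)
Lemma pointsb_step S p q p' q' : is_zigzag S -> pointsb S p q -> pointsb S p' q' ->
  p - q < p' - q' -> pointsb S (p' - 1) q' || pointsb S p' (q' + 1).
Proof. by case: S => [a b|r a b|r a b|d a b] //= _; lia. Qed.

Lemma pointsb_step_op S p q p' q' : is_zigzag S -> pointsb S p q -> pointsb S p' q' ->
  p' - q' < p - q -> pointsb S (p' + 1) q' || pointsb S p' (q' - 1).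
Proof. by case: S => [a b|r a b|r a b|d a b] //= _; lia. Qed.

Lemma pointsb_diag S p q p' q' : is_zigzag S -> pointsb S p q -> pointsb S p' q' ->
  p' - q' = p - q -> p' = p /\ q' = q.
Proof. by case: S => [a b|r a b|r a b|d a b] //= _; lia. Qed.

(** In a square, the first degree is adjusted before the second. In a zigzag, the induction is on
    the difference of the values of [p - q], the distance along the path. *)
Lemma pointsb_connected S (G : int -> int -> Prop) :
  (forall p q, G p q -> pointsb S (p + 1) q -> G (p + 1) q) ->
  (forall p q, G p q -> pointsb S p (q + 1) -> G p (q + 1)) ->
  (forall p q, G (p + 1) q -> pointsb S p q -> G p q) ->
  (forall p q, G p (q + 1) -> pointsb S p q -> G p q) ->
  forall p q p' q', G p q -> pointsb S p q -> pointsb S p' q' -> G p' q'.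
Proof.
move=> u1 u2 v1 v2 p q p' q' Gpq.
have v1' a b : G a b -> pointsb S (a - 1) b -> G (a - 1) b.
  by move=> ab; apply: v1; rewrite subrK.
have v2' a b : G a b -> pointsb S a (b - 1) -> G a (b - 1).
  by move=> ab; apply: v2; rewrite subrK.
have [zS|] := boolP (is_zigzag S); last first.
  case: S u1 u2 v1 v2 v1' v2' => // a b u1 u2 v1 v2 v1' v2' _ Spq Spq'.
  have [pa|pa] : p = a \/ p = a - 1 by move: Spq => /=; lia.
  - have Gp' : G p' q.
      have [->|e] : p' = p \/ p' = p - 1 by move: Spq' => /=; lia.
        by [].
      by rewrite e; apply: v1' => //; move: Spq' Spq => /=; lia.
    have [->|[e|e]] : q' = q \/ q' = q + 1 \/ q' = q - 1 by move: Spq Spq' => /=; lia.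
    + by [].
    + by rewrite e; apply: u2 => //; move: Spq' Spq => /=; lia.
    + by rewrite e; apply: v2' => //; move: Spq' Spq => /=; lia.
  - have Gp' : G p' q.
      have [->|e] : p' = p \/ p' = p + 1 by move: Spq' => /=; lia.
        by [].
      by rewrite e; apply: u1 => //; move: Spq' Spq => /=; lia.
    have [->|[e|e]] : q' = q \/ q' = q + 1 \/ q' = q - 1 by move: Spq Spq' => /=; lia.
    + by [].
    + by rewrite e; apply: u2 => //; move: Spq' Spq => /=; lia.
    + by rewrite e; apply: v2' => //; move: Spq' Spq => /=; lia.
move=> Spq; move en : (absz (p' - q' - (p - q))%R) => n.
elim: n p' q' en => [|n IH] p' q' en Spq'.
  by have [|-> ->] := pointsb_diag zS Spq Spq'; first lia.
have [lt|gt|eq] := ltgtP (p - q) (p' - q'); last by lia.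
- have /orP[S1|S1] := pointsb_step zS Spq Spq' lt.
    by rewrite -(subrK 1 p'); apply: u1; rewrite ?subrK //; apply: IH => //; lia.
  by rewrite -(addrK 1 q'); apply: v2'; rewrite ?addrK //; apply: IH => //; lia.
- have /orP[S1|S1] := pointsb_step_op zS Spq Spq' gt.
    by rewrite -(addrK 1 p'); apply: v1'; rewrite ?addrK //; apply: IH => //; lia.
  by rewrite -(subrK 1 q'); apply: u2; rewrite ?subrK //; apply: IH => //; lia.
Qed.

(** Opposite corners of a square and the endpoints of a zigzag, tested for membership in the other
    shape, separate the families and determine the parameters. *)
Lemma pointsb_inj S S' : pointsb S =2 pointsb S' -> S = S'.
Proof.
move=> e.
have e1 p q : pointsb S p q -> pointsb S' p q by rewrite e.
have e2 p q : pointsb S' p q -> pointsb S p q by rewrite e.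
case: S S' e1 e2 {e} => [a b|r a b|r a b|d a b] [a' b'|r' a' b'|r' a' b'|d' a' b']
  e1 e2.
- have s1 := e1 a b ltac:(by rewrite /=; lia).
  have s2 := e1 (a - 1) (b - 1) ltac:(by rewrite /=; lia).
  have s3 := e2 a' b' ltac:(by rewrite /=; lia).
  have s4 := e2 (a' - 1) (b' - 1) ltac:(by rewrite /=; lia).
  move: s1 s2 s3 s4 => /= {e1 e2} s1 s2 s3 s4.
  by have [-> ->] : a = a' /\ b = b' by lia.
- have s1 := e1 a b ltac:(by rewrite /=; lia).
  have s2 := e1 (a - 1) (b - 1) ltac:(by rewrite /=; lia).
  have s3 := e2 a' b' ltac:(by rewrite /=; lia).
  have s4 := e2 (a' + r'%:Z + 1) (b' - r'%:Z) ltac:(by rewrite /=; lia).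
  move: s1 s2 s3 s4 => /= {e1 e2} s1 s2 s3 s4; lia.
- have s1 := e1 a b ltac:(by rewrite /=; lia).
  have s2 := e1 (a - 1) (b - 1) ltac:(by rewrite /=; lia).
  have s3 := e2 a' b' ltac:(by rewrite /=; lia).
  have s4 := e2 (a' - r'%:Z) (b' + r'%:Z + 1) ltac:(by rewrite /=; lia).
  move: s1 s2 s3 s4 => /= {e1 e2} s1 s2 s3 s4; lia.
- have s1 := e1 a b ltac:(by rewrite /=; lia).
  have s2 := e1 (a - 1) (b - 1) ltac:(by rewrite /=; lia).
  have s3 := e2 a' (d' - a') ltac:(by rewrite /=; lia).
  have s4 := e2 (d' - b') b' ltac:(by rewrite /=; lia).
  move: s1 s2 s3 s4 => /= {e1 e2} s1 s2 s3 s4; lia.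
- have s1 := e1 a b ltac:(by rewrite /=; lia).
  have s2 := e1 (a + r%:Z + 1) (b - r%:Z) ltac:(by rewrite /=; lia).
  have s3 := e2 a' b' ltac:(by rewrite /=; lia).
  have s4 := e2 (a' - 1) (b' - 1) ltac:(by rewrite /=; lia).
  move: s1 s2 s3 s4 => /= {e1 e2} s1 s2 s3 s4; lia.
- have s1 := e1 a b ltac:(by rewrite /=; lia).
  have s2 := e1 (a + r%:Z + 1) (b - r%:Z) ltac:(by rewrite /=; lia).
  have s3 := e2 a' b' ltac:(by rewrite /=; lia).
  have s4 := e2 (a' + r'%:Z + 1) (b' - r'%:Z) ltac:(by rewrite /=; lia).
  move: s1 s2 s3 s4 => /= {e1 e2} s1 s2 s3 s4.
  by have [-> [-> ->]] : r = r' /\ a = a' /\ b = b' by lia.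
- have s1 := e1 a b ltac:(by rewrite /=; lia).
  have s2 := e1 (a + r%:Z + 1) (b - r%:Z) ltac:(by rewrite /=; lia).
  have s3 := e2 a' b' ltac:(by rewrite /=; lia).
  have s4 := e2 (a' - r'%:Z) (b' + r'%:Z + 1) ltac:(by rewrite /=; lia).
  move: s1 s2 s3 s4 => /= {e1 e2} s1 s2 s3 s4; lia.
- have s1 := e1 a b ltac:(by rewrite /=; lia).
  have s2 := e1 (a + r%:Z + 1) (b - r%:Z) ltac:(by rewrite /=; lia).
  have s3 := e2 a' (d' - a') ltac:(by rewrite /=; lia).
  have s4 := e2 (d' - b') b' ltac:(by rewrite /=; lia).
  move: s1 s2 s3 s4 => /= {e1 e2} s1 s2 s3 s4; lia.
- have s1 := e1 a b ltac:(by rewrite /=; lia).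
  have s2 := e1 (a - r%:Z) (b + r%:Z + 1) ltac:(by rewrite /=; lia).
  have s3 := e2 a' b' ltac:(by rewrite /=; lia).
  have s4 := e2 (a' - 1) (b' - 1) ltac:(by rewrite /=; lia).
  move: s1 s2 s3 s4 => /= {e1 e2} s1 s2 s3 s4; lia.
- have s1 := e1 a b ltac:(by rewrite /=; lia).
  have s2 := e1 (a - r%:Z) (b + r%:Z + 1) ltac:(by rewrite /=; lia).
  have s3 := e2 a' b' ltac:(by rewrite /=; lia).
  have s4 := e2 (a' + r'%:Z + 1) (b' - r'%:Z) ltac:(by rewrite /=; lia).
  move: s1 s2 s3 s4 => /= {e1 e2} s1 s2 s3 s4; lia.
- have s1 := e1 a b ltac:(by rewrite /=; lia).
  have s2 := e1 (a - r%:Z) (b + r%:Z + 1) ltac:(by rewrite /=; lia).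
  have s3 := e2 a' b' ltac:(by rewrite /=; lia).
  have s4 := e2 (a' - r'%:Z) (b' + r'%:Z + 1) ltac:(by rewrite /=; lia).
  move: s1 s2 s3 s4 => /= {e1 e2} s1 s2 s3 s4.
  by have [-> [-> ->]] : r = r' /\ a = a' /\ b = b' by lia.
- have s1 := e1 a b ltac:(by rewrite /=; lia).
  have s2 := e1 (a - r%:Z) (b + r%:Z + 1) ltac:(by rewrite /=; lia).
  have s3 := e2 a' (d' - a') ltac:(by rewrite /=; lia).
  have s4 := e2 (d' - b') b' ltac:(by rewrite /=; lia).
  move: s1 s2 s3 s4 => /= {e1 e2} s1 s2 s3 s4; lia.
- have s1 := e1 a (d - a) ltac:(by rewrite /=; lia).
  have s2 := e1 (d - b) b ltac:(by rewrite /=; lia).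
  have s3 := e2 a' b' ltac:(by rewrite /=; lia).
  have s4 := e2 (a' - 1) (b' - 1) ltac:(by rewrite /=; lia).
  move: s1 s2 s3 s4 => /= {e1 e2} s1 s2 s3 s4; lia.
- have s1 := e1 a (d - a) ltac:(by rewrite /=; lia).
  have s2 := e1 (d - b) b ltac:(by rewrite /=; lia).
  have s3 := e2 a' b' ltac:(by rewrite /=; lia).
  have s4 := e2 (a' + r'%:Z + 1) (b' - r'%:Z) ltac:(by rewrite /=; lia).
  move: s1 s2 s3 s4 => /= {e1 e2} s1 s2 s3 s4; lia.
- have s1 := e1 a (d - a) ltac:(by rewrite /=; lia).
  have s2 := e1 (d - b) b ltac:(by rewrite /=; lia).
  have s3 := e2 a' b' ltac:(by rewrite /=; lia).
  have s4 := e2 (a' - r'%:Z) (b' + r'%:Z + 1) ltac:(by rewrite /=; lia).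
  move: s1 s2 s3 s4 => /= {e1 e2} s1 s2 s3 s4; lia.
- have s1 := e1 a (d - a); have s2 := e1 (d - b) b.
  have s3 := e2 a' (d' - a'); have s4 := e2 (d' - b') b'.
  (* Odd zigzags bending in opposite directions can share both endpoints; these extra points tell
     them apart. *)
  have s5 := e1 (a + 1) (d - a); have s6 := e2 (a' + 1) (d' - a').
  move: s1 s2 s3 s4 s5 s6 => /= {e1 e2}; case: (leP (a + b) d) => ab;
    case: (leP (a' + b') d') => ab' s1 s2 s3 s4 s5 s6.
  + by have [-> [-> ->]] : d = d' /\ a = a' /\ b = b' by lia.
  + by exfalso; lia.
  + by exfalso; lia.
  + by have [-> [-> ->]] : d = d' /\ a = a' /\ b = b' by lia.
Qed.

(** * Morphisms between zigzags *)

Section ZigzagMaps.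
Variable K : fieldType.

(* The bidegrees in which v u is nonzero are closed under neighbours in S and in
   S'; as shapes are connected, both shapes consist of these bidegrees. *)
Lemma zigzag_comp0 S S' (u : dhom (shapeC K S) (shapeC K S'))
    (v : dhom (shapeC K S') (shapeC K S)) :
  S <> S' -> forall p q x, v p q (u p q x) = 0.
Proof.
move=> SS' p0 q0 x0; apply: contrapT => x0P; apply: SS'.
pose G p q := exists x, v p q (u p q x) <> 0.
have nz T (w : dhom (shapeC K S) (shapeC K T)) p q x : w p q x <> 0 -> x <> 0.
  by move=> + x0'; apply; rewrite x0' linear0.
have nz' T (w : dhom (shapeC K T) (shapeC K S)) p q x : w p q x <> 0 -> x <> 0.
  by move=> + x0'; apply; rewrite x0' linear0.
have GS p q : G p q -> pointsb S p q.
  by move=> [x /nz' /nz /shapeC_mem]; rewrite in_points.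
have GS' p q : G p q -> pointsb S' p q.
  by move=> [x /nz' /shapeC_mem]; rewrite in_points.
have bij1 T p q : pointsb T p q -> pointsb T (p + 1) q ->
    bijective (d1 (shapeC K T) p q).
  by move=> *; apply: C_d1_bij; rewrite in_points.
have bij2 T p q : pointsb T p q -> pointsb T p (q + 1) ->
    bijective (d2 (shapeC K T) p q).
  by move=> *; apply: C_d2_bij; rewrite in_points.
have inj1 T p q x : pointsb T p q -> pointsb T (p + 1) q -> x <> 0 ->
    d1 (shapeC K T) p q x <> 0.
  move=> Tp Tp' xn dx; apply: xn; apply: (bij_inj (bij1 _ _ _ Tp Tp')).
  by rewrite dx linear0.
have inj2 T p q x : pointsb T p q -> pointsb T p (q + 1) -> x <> 0 ->
    d2 (shapeC K T) p q x <> 0.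
  move=> Tp Tp' xn dx; apply: xn; apply: (bij_inj (bij2 _ _ _ Tp Tp')).
  by rewrite dx linear0.
have u1 p q : G p q -> pointsb S (p + 1) q -> G (p + 1) q.
  move=> Gpq Sp; have [x xP] := Gpq; exists (d1 _ _ _ x); rewrite !dhom_d1.
  exact: inj1 (GS _ _ Gpq) _ _.
have u2 p q : G p q -> pointsb S p (q + 1) -> G p (q + 1).
  move=> Gpq Sp; have [x xP] := Gpq; exists (d2 _ _ _ x); rewrite !dhom_d2.
  exact: inj2 (GS _ _ Gpq) _ _.
have v1 p q : G (p + 1) q -> pointsb S p q -> G p q.
  move=> Gpq Sp; have [x] := Gpq; have [g _ gK] := bij1 _ _ _ Sp (GS _ _ Gpq).
  by rewrite -(gK x) !dhom_d1 => xP; exists (g x) => z; apply: xP; rewrite z linear0.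
have v2 p q : G p (q + 1) -> pointsb S p q -> G p q.
  move=> Gpq Sp; have [x] := Gpq; have [g _ gK] := bij2 _ _ _ Sp (GS _ _ Gpq).
  by rewrite -(gK x) !dhom_d2 => xP; exists (g x) => z; apply: xP; rewrite z linear0.
(* A neighbour in [S'] is first shown to lie in [S]. For an outgoing differential, [d1 x] is nonzero
   because its image under [u] is; for an incoming one, [v] is nonzero on the preimage of [u x]. *)
have u1' p q : G p q -> pointsb S' (p + 1) q -> G (p + 1) q.
  move=> Gpq Sp; apply: u1 => //; have [x xP] := Gpq; rewrite -in_points.
  apply: (@shapeC_mem K _ _ _ (d1 _ _ _ x)); apply: nz; rewrite dhom_d1.
  by apply: inj1 (GS' _ _ Gpq) Sp _; apply: nz' xP.
have u2' p q : G p q -> pointsb S' p (q + 1) -> G p (q + 1).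
  move=> Gpq Sp; apply: u2 => //; have [x xP] := Gpq; rewrite -in_points.
  apply: (@shapeC_mem K _ _ _ (d2 _ _ _ x)); apply: nz; rewrite dhom_d2.
  by apply: inj2 (GS' _ _ Gpq) Sp _; apply: nz' xP.
have v1' p q : G (p + 1) q -> pointsb S' p q -> G p q.
  move=> Gpq Sp; apply: v1 => //; have [x] := Gpq.
  have [g _ gK] := bij1 _ _ _ Sp (GS' _ _ Gpq); rewrite -(gK (u _ _ x)) dhom_d1 => xP.
  rewrite -in_points; apply: (@shapeC_mem K _ _ _ (v p q (g (u _ _ x)))) => z.
  by apply: xP; rewrite z linear0.
have v2' p q : G p (q + 1) -> pointsb S' p q -> G p q.
  move=> Gpq Sp; apply: v2 => //; have [x] := Gpq.
  have [g _ gK] := bij2 _ _ _ Sp (GS' _ _ Gpq); rewrite -(gK (u _ _ x)) dhom_d2 => xP.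
  rewrite -in_points; apply: (@shapeC_mem K _ _ _ (v p q (g (u _ _ x)))) => z.
  by apply: xP; rewrite z linear0.
have G0 : G p0 q0 by exists x0.
apply: pointsb_inj => p q; apply/idP/idP => Spq.
  by apply: GS'; apply: pointsb_connected u1 u2 v1 v2 _ _ _ _ G0 (GS _ _ G0) Spq.
by apply: GS; apply: pointsb_connected u1' u2' v1' v2' _ _ _ _ G0 (GS' _ _ G0) Spq.
Qed.

Lemma zigzag_d1d2 S : is_zigzag S ->
  forall t : tot (shapeC K S), td1 (shapeC K S) (td2 (shapeC K S) t) = 0.
Proof.
move=> zS t; apply: tot_ext; apply: totS1; apply: totS2 => p q; rewrite td1E td2E.
rewrite -[LHS]/(t p q *m const_mx _ *m const_mx _) mul_const_mx2.
apply: mul_const_mx0; rewrite !in_points => h h'.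
suff -> : pointsb S p (q + 1) = false by rewrite mulr0n.
by case: S zS {t} h h' => [a b|r a b|r a b|d a b] //= _ h h'; lia.
Qed.

Lemma rV_square_zero (b : bool) (f : {linear 'rV[K]_b -> 'rV[K]_b}) :
  (forall x, f (f x) = 0) -> forall x, f x = 0.
Proof.
move=> ff x; set e : 'rV[K]_b := const_mx 1.
have fE y : f y = rcoord y *: f e by rewrite -{1}(rcoordK y) linearZ.
have /eqP := ff e; rewrite (fE (f e)) scaler_eq0 => /orP[/eqP c0|/eqP fe0].
  by rewrite fE -(rcoordK (f e)) c0 scale0r scaler0.
by rewrite fE fe0 scaler0.
Qed.

(* As d1 d2 = 0 on C(S), a null endomorphism has square zero. *)
Lemma zigzag_sq0 S (k : {linear tot (shapeC K S) -> tot (shapeC K S)}) p q x :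
  is_zigzag S -> sqhom k p q x = 0.
Proof.
move=> /zigzag_d1d2 zS; move: x; apply: rV_square_zero => x.
rewrite sqhomE.
have zS' (t : tot (shapeC K S)) : td2 (shapeC K S) (td1 (shapeC K S) t) = 0.
  by rewrite td12 zS oppr0.
(* Since [d1 d2 = 0], the values of [sqhom k] are killed by both differentials, and on such elements
   [sqhom k] vanishes. *)
have e1 : d1 _ _ _ (sqhom k p q x) = 0.
  by rewrite -dhom_d1 sqhomE -td1_tin sqE td11 !zS zS' !linear0 !addr0.
have e2 : d2 _ _ _ (sqhom k p q x) = 0.
  by rewrite -dhom_d2 sqhomE -td2_tin sqE td22 !zS !linear0 !addr0.
by rewrite sqE zS td1_tin td2_tin e1 e2 !linear0 !addr0.
Qed.

End ZigzagMaps.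

(** * Multiplicities *)

Section Dimension.
Variables (K : fieldType) (C : lmodType K) (c1 : C) (I J : Type).
Hypothesis c1_neq0 : c1 <> 0.
Hypothesis C_dim1 : forall x y : C, x <> 0 -> exists a, y = a *: x.
Variable L : {linear dsum (fun _ : I => C) -> dsum (fun _ : J => C)}.
Hypothesis L_inj : forall x, L x = 0 -> x = 0.

(* Steinitz exchange: G is a partial injection along which basis vectors of the
   source may be replaced by basis vectors of the target, keeping independence. *)
Let exchange (G : set (I * J)) : Prop :=
  [/\ forall i j j', G (i, j) -> G (i, j') -> j = j',
      forall i i' j, G (i, j) -> G (i', j) -> i = i'
    & forall x : dsum (fun _ : I => C), (forall i j, G (i, j) -> val x i = 0) ->
        (forall j, val (L x) j <> 0 -> exists i, G (i, j)) -> x = 0].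

(** The third condition passes to unions because [L x] has finite support: the pairs needed for a
    given [x] already lie in one member of the chain. *)
Lemma exchange_chain (F : set (set (I * J))) : F `<=` exchange -> total_on F subset ->
  exchange (\bigcup_(X in F) X).
Proof.
move=> FP Fch.
have pick x y : (\bigcup_(X in F) X) x -> (\bigcup_(X in F) X) y ->
    exists2 X, F X & X x /\ X y.
  move=> [X FX Xx] [Y FY Yy].
  by have [XY|YX] := Fch _ _ FX FY; [exists Y|exists X] => //; split=> //;
    [apply: XY|apply: YX].
split.
- move=> i j j' h h'; have [X /FP[fX _ _] [Xj Xj']] := pick _ _ h h'.
  exact: fX Xj Xj'.
- move=> i i' j h h'; have [X /FP[_ iX _] [Xi Xi']] := pick _ _ h h'.
  exact: iX Xi Xi'.
move=> x xF LxF; have [s _ sE] := dsum_suppP (L x).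
pose t : seq {classic J} := [seq j <- s | val (L x) j != 0].
(* The first alternative covers the empty chain; there [L x = 0], so injectivity applies. *)
have [t0|[X FX Xt]] : t = [::] \/
    exists2 X, F X & forall j : {classic J}, j \in t -> exists i, X (i, j).
  have : {in t, forall j : {classic J}, exists i, (\bigcup_(X in F) X) (i, j)}.
    by move=> j; rewrite mem_filter => /andP[/eqP ? _]; apply: LxF.
  elim: t => [|j t IH] tF; [by left|right].
  have [i [X FX Xij]] := tF j (mem_head _ _).
  case: IH => [j' j't|t0|[Y FY Yt]].
  - by apply: tF; rewrite inE j't orbT.
  - by exists X => // j'; rewrite t0 inE => /eqP ->; exists i.
  - have [XY|YX] := Fch _ _ FX FY; [exists Y|exists X] => // j';
      rewrite inE => /orP[/eqP->|].
    + by exists i; apply: XY.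
    + exact: Yt.
    + by exists i.
    + by move=> /Yt[i' ?]; exists i'; apply: YX.
  apply: L_inj; apply: dsum_ext => j; apply/eqP; apply: contraT => Lj.
  suff: (j : {classic J}) \in t by rewrite t0.
  by rewrite mem_filter Lj; apply: contraT => /sE Lj0; rewrite Lj0 eqxx in Lj.
have [_ _ XP] := FP _ FX; apply: XP => [i j Xij|j Lj].
  by apply: (xF i j); exists X.
apply: Xt; rewrite mem_filter; apply/andP; split; first exact/eqP.
by apply: contraT => /sE.
Qed.

(** In a maximal partial injection every [i] is matched. Otherwise no free [j] could be paired with
    [i], and modulo the matched coordinates every target vector would come from a source vector
    without coordinate [i], including the image of the basis vector at [i]. *)
Lemma dsum_embedding : exists h : I -> J, injective h.
Proof.
have [G [[fG iG GP] Gmax]] := Zorn_bigcup exchange_chain.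
have domG i : exists j, G (i, j).
  apply: contrapT => ni; pose ran j := exists i', G (i', j).
  (* By maximality [G] together with [(i, j)] violates independence; [x] witnesses this, and its
     image is nonzero at [j] because [G] itself is independent. *)
  have H j : ~ ran j -> exists x : dsum (fun _ : I => C),
      [/\ val x i = 0, forall i' j', G (i', j') -> val x i' = 0,
          forall j', val (L x) j' <> 0 -> ran j' \/ j' = j & val (L x) j <> 0].
    move=> nj; apply: contrapT => nx; apply: (Gmax (G `|` [set (i, j)])).
      split=> [z Gz|]; first by left.
      by move=> /(_ (i, j)) h; apply: ni; exists j; apply: h; right.
    split.
    - move=> i1 j1 j2 [h1|[? ?]] [h2|[? ?]]; subst => //; first exact: fG h1 h2.
      + by case: ni; exists j1.
      + by case: ni; exists j2.
    - move=> i1 i2 j1 [h1|[? ?]] [h2|[? ?]]; subst => //; first exact: iG h1 h2.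
      + by case: nj; exists i1.
      + by case: nj; exists i2.
    - move=> x xG Lx; apply: contrapT => x0; apply: nx; exists x; split.
      + by apply: (xG i j); right.
      + by move=> i' j' Gij; apply: (xG i' j'); left.
      + by move=> j' /Lx[i' [Gij|[_ ->]]]; [left; exists i'|right].
      + move=> Lj; apply: x0; apply: GP => [i' j' Gij|j' Lj'].
          by apply: (xG i' j'); left.
        have [i' [Gij|[_ jj]]] := Lx _ Lj'; first by exists i'.
        by rewrite jj in Lj'.
  have span (y : dsum (fun _ : J => C)) : exists x : dsum (fun _ : I => C),
      [/\ val x i = 0, forall i' j', G (i', j') -> val x i' = 0
        & forall j', ~ ran j' -> val y j' = val (L x) j'].
    move: y; apply: (@dsum_ind K J (fun _ => C)) =>
      [|y z [x [xi xG xy]] [x' [xi' xG' xz]]|j v].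
    - by exists 0; split=> [||j' _]; [by []|by []|rewrite (linear0 L)].
    - exists (x + x'); split.
      + by rewrite -[LHS]/(val x i + val x' i) xi xi' addr0.
      + move=> a b ab; rewrite -[LHS]/(val x a + val x' a).
        by rewrite (xG _ _ ab) (xG' _ _ ab) addr0.
      + move=> j' nj'; rewrite (linearD L) -[LHS]/(val y j' + val z j').
        by rewrite xy ?xz.
    - have [rj|nj] := pselect (ran j).
        exists 0; split=> // j' nj'; rewrite (linear0 L) dsingle_ne // => jj.
        by apply: nj'; rewrite -jj.
      have [x [xi xG xL xj]] := H j nj; have [a vE] := C_dim1 v xj.
      exists (a *: x); split.
      + by rewrite -[LHS]/(a *: val x i) xi scaler0.
      + by move=> i' j' Gij; rewrite -[LHS]/(a *: val x i') (xG _ _ Gij) scaler0.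
      + move=> j' nj'; rewrite (linearZ_LR L) -[RHS]/(a *: val (L x) j').
        have [jj|jj] := pselect (j = j'); first by rewrite -jj dsingle_id.
        rewrite dsingle_ne //; have [->|Lj'] := pselect (val (L x) j' = 0).
          by rewrite scaler0.
        by have [//|/esym] := xL _ Lj'.
  (* The difference of the basis vector at [i] and [x] satisfies the premises of [GP], yet its
     coordinate at [i] is [c1]. *)
  have [x [xi xG xL]] := span (L (dsingle _ i c1)).
  have z0 : dsingle _ i c1 - x = 0.
    apply: GP => [i' j' Gij|j' Lj'].
      rewrite -[LHS]/(val (dsingle _ i c1) i' - val x i') (xG _ _ Gij) subr0.
      rewrite dsingle_ne //.
      by move=> ii; apply: ni; exists j'; rewrite ii.
    apply: contrapT => nj'; apply: Lj'; rewrite (linearB L).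
    by rewrite -[LHS]/(val (L _) j' - val (L x) j') (xL _ nj') subrr.
  have : val (dsingle _ i c1) i - val x i = 0.
    exact: (congr1 (fun z : dsum (fun _ : I => C) => val z i) z0).
  by rewrite xi subr0 dsingle_id; exact: c1_neq0.
have [h hG] := choice domG; exists h => i i' hh.
by apply: iG (hG i) _; rewrite hh; apply: hG.
Qed.

End Dimension.

Lemma equipotent_of_inj (X Y : Type) (f : X -> Y) (g : Y -> X) :
  injective f -> injective g -> equipotent X Y.
Proof.
move=> fI gI.
have leT (U V : Type) (h : U -> V) : injective h -> ([set: U] #<= [set: V])%card.
  move=> hI; rewrite -(preimage_setT h).
  by apply: card_ge_preimage => x y _ _; apply: hI.
have /card_bijP[h [h' hK h'K]] := Cantor_Bernstein (leT _ _ _ fI) (leT _ _ _ gI).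
pose inT (U : Type) (x : U) : [set: U] := SigSub (in_setT x).
exists (fun x => val (h (inT X x))), (fun y => val (h' (inT Y y))) => z.
  by rewrite (_ : inT Y _ = h (inT X z)) ?hK //; apply: val_inj.
by rewrite (_ : inT X _ = h' (inT Y z)) ?h'K //; apply: val_inj.
Qed.

(** * Isotypic components of a direct sum of shapes *)

Section Components.
Variables (K : fieldType).

Section Fixed.
Variables (I : Type) (D : I -> dcomplex K).

Lemma dsum_map_single (V W : I -> lmodType K) (f : forall i, {linear V i -> W i}) i v :
  dsum_map f (dsingle V i v) = dsingle W i (f i v).
Proof.
apply: dsum_ext => j; rewrite -[LHS]/(f j (val (dsingle V i v) j)).
have [<-|ij] := pselect (i = j); first by rewrite !dsingle_id.
by rewrite !dsingle_ne // linear0.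
Qed.

Definition dcinj i : dhom (D i) (dcsum D) :=
  @DHom K (D i) (dcsum D) (fun p q => dsingle (fun j => D j p q) i)
    (fun p q x => esym (dsum_map_single (fun j => d1 (D j) p q) x))
    (fun p q x => esym (dsum_map_single (fun j => d2 (D j) p q) x)).

Definition dccoord_fun i p q (x : dcsum D p q) : D i p q := val x i.
Lemma dccoord_linear i p q : linear (@dccoord_fun i p q).
Proof. by []. Qed.
Definition dcproj i : dhom (dcsum D) (D i) :=
  @DHom K (dcsum D) (D i) (fun p q => linear_of (@dccoord_linear i p q))
    (fun _ _ _ => erefl) (fun _ _ _ => erefl).

End Fixed.

Lemma dsum_eq0_single (I : Type) (V : I -> lmodType K) (W : lmodType K)
    (phi : {linear dsum V -> W}) (y : dsum V) :
  (forall i, phi (dsingle V i (val y i)) = 0) -> phi y = 0.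
Proof.
have [s _] := dsum_suppP y; elim: s y => [|i s IH] y ys phi0.
  by rewrite (_ : y = 0) ?linear0 //; apply: dsum_ext => i; apply: ys.
rewrite -[y](subrK (dsingle _ i (val y i))) linearD phi0 addr0; apply: IH => j.
  move=> js; rewrite -[LHS]/(val y j - val (dsingle V i (val y i)) j).
  have [<-|ij] := pselect (i = j); first by rewrite dsingle_id subrr.
  rewrite dsingle_ne // ys ?subr0 // inE negb_or js andbT.
  by apply/eqP => ji; apply: ij.
rewrite (_ : val _ j = val y j - val (dsingle V i (val y i)) j) //.
have [<-|ij] := pselect (i = j); first by rewrite dsingle_id subrr linear0 linear0.
by rewrite dsingle_ne // subr0.
Qed.

Lemma existT_inj (X : Type) (P : X -> Type) x (a b : P x) :
  existT P x a = existT P x b -> a = b.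
Proof.
move=> e; have := projT2_eq e.
by rewrite /= (Prop_irrelevance (projT1_eq e) erefl).
Qed.

Section Isotypic.
Variables (V : dshape -> lmodType K) (m : dshape -> Type) (S : dshape).
Let VV (s : {T : dshape & m T}) := V (projT1 s).

Lemma iso_restr_subproof (y : dsum VV) :
  ((fun i => val y (existT m S i)) : dprod (fun _ : m S => V S)) \in @finsupp K _ _.
Proof.
have := submod_valP y; rewrite !inE /= => fy.
apply: (finite_preimage _ fy (f := existT m S)) => i j _ _; exact: existT_inj.
Qed.
Definition iso_restr_fun (y : dsum VV) : dsum (fun _ : m S => V S) :=
  Submod (iso_restr_subproof y).
Lemma iso_restr_linear : linear iso_restr_fun.
Proof. by move=> a x y; apply: dsum_ext. Qed.
Definition iso_restr := linear_of iso_restr_linear.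

Lemma iso_restrE y i : val (iso_restr y) i = val y (existT m S i).
Proof. by []. Qed.

Lemma iso_ext_exists : exists e : {linear dsum (fun _ : m S => V S) -> dsum VV},
  forall i v, e (dsingle _ i v) = dsingle VV (existT m S i) v.
Proof. exact: (dsum_lift (fun i => dsingle VV (existT m S i))). Qed.

Lemma iso_restr_single i v :
  iso_restr (dsingle VV (existT m S i) v) = dsingle _ i v.
Proof.
apply: dsum_ext => j; rewrite iso_restrE.
have [->|ij] := pselect (i = j); first by rewrite !dsingle_id.
by rewrite !dsingle_ne // => e; apply: ij; exact: existT_inj e.
Qed.

Lemma iso_restr_single_ne s v : projT1 s <> S -> iso_restr (dsingle VV s v) = 0.
Proof.
move=> sS; apply: dsum_ext => j; rewrite iso_restrE dsingle_ne //.
by move=> e; apply: sS; rewrite e.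
Qed.

End Isotypic.

Lemma isomorphic_inv (A B : dcomplex K) : isomorphic A B ->
  exists (f : dhom A B) (g : dhom B A),
    (forall p q, cancel (f p q) (g p q)) /\ (forall p q, cancel (g p q) (f p q)).
Proof.
move=> [f fbij].
have G p q : {g : {linear B p q -> A p q} | cancel (f p q) g /\ cancel g (f p q)}.
  apply: cid; have [g gK Kg] := fbij p q.
  have lg : linear g.
    by move=> a x y; apply: (can_inj gK); rewrite Kg linearP !Kg.
  by exists (linear_of lg).
have gK p q : cancel (f p q) (sval (G p q)) by case: (G p q) => ? [].
have Kg p q : cancel (sval (G p q)) (f p q) by case: (G p q) => ? [].
have g1 p q x : sval (G (p + 1) q) (d1 B p q x) = d1 A p q (sval (G p q) x).
  by apply: (can_inj (gK _ _)); rewrite Kg dhom_d1 Kg.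
have g2 p q x : sval (G p (q + 1)) (d2 B p q x) = d2 A p q (sval (G p q) x).
  by apply: (can_inj (gK _ _)); rewrite Kg dhom_d2 Kg.
by exists f, (@DHom K B A (fun p q => sval (G p q)) g1 g2).
Qed.

(** Null morphisms form an ideal: chain maps on either side can be absorbed into the
    null-homotopy. *)
Lemma sqhom_conj (A B C D : dcomplex K) (u : dhom A B) (v : dhom C D)
  (k : {linear tot B -> tot C}) p q x :
  v p q (sqhom k p q (u p q x)) = sqhom (tmap v \o (k \o tmap u)) p q x.
Proof.
have e t : tmap v (sq k (tmap u t)) = sq (tmap v \o (k \o tmap u)) t.
  rewrite !sqE (linearD (tmap v)) (linearB (tmap v)) (linearD (tmap v)).
  by rewrite !tmap_td1 !tmap_td2 -!(tmap_td1 u) -!(tmap_td2 u) -!(tmap_td1 u).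
by rewrite !sqhomE -tmapE -tmap_tin e.
Qed.

End Components.

Lemma zigzag_point S : is_zigzag S -> exists p q, pointsb S p q.
Proof.
case: S => [a b|r a b|r a b|d a b] //= _; [exists a, b|exists a, b|exists a, (d - a)];
  lia.
Qed.

Section Multiplicities.
Variables (K : fieldType) (A B : dcomplex K) (mA mB : dshape -> Type).
Hypotheses (isoA : multiplicities A mA) (isoB : multiplicities B mB).

(** In a bidegree of [S], the part of [g f] from [S] to [S] is the identity, as null endomorphisms
    of C(S) vanish. Detours through other shapes contribute 0, so [f] is already injective between
    the [S]-components. *)
Lemma zigzag_mult_inj (f : dhom A B) (g : dhom B A) (k : {linear tot A -> tot A}) S :
  is_zigzag S -> (forall p q x, g p q (f p q x) = x - sqhom k p q x) ->
  exists h : mA S -> mB S, injective h.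
Proof.
move=> zS gf; have [p [q Spq]] := zigzag_point zS.
have [a [a' [aK a'K]]] := isomorphic_inv isoA.
have [b [b' [bK b'K]]] := isomorphic_inv isoB.
pose V T : lmodType K := shapeC K T p q.
pose u := dhom_comp b (dhom_comp f a'); pose v := dhom_comp a (dhom_comp g b').
have vu x : v p q (u p q x) = x - a p q (sqhom k p q (a' p q x)).
  rewrite -[LHS]/(a p q (g p q (b' p q (b p q (f p q (a' p q x)))))).
  by rewrite bK gf linearB a'K.
have [eX eXE] := iso_ext_exists V mA S; have [eY eYE] := iso_ext_exists V mB S.
pose rX := iso_restr V mA S; pose rY := iso_restr V mB S.
have rvu x : rX (v p q (eY (rY (u p q (eX x))))) = x.
  move: x; apply: (@dsum_ind K (mA S) (fun _ => V S)) => [|x y xE yE|i c].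
  - by rewrite !linear0.
  - by rewrite !linearD xE yE.
  apply: dsum_ext => i'; rewrite eXE.
  set x := dsingle _ (existT mA S i) c; set y := u p q x.
  pose Y := dcsum (fun s : {T : dshape & mB T} => shapeC K (projT1 s)).
  (* [phi] measures the contribution of the summands of [B] of shape other than [S] to the
     coordinate [i']. *)
  pose phi : {linear Y p q -> V S} :=
    dcproj _ (existT mA S i') p q \o (v p q \o (idfun \- (eY \o rY))).
  have phiE z : phi z =
      val (v p q z) (existT mA S i') - val (rX (v p q (eY (rY z)))) i'.
    by rewrite -[LHS]/(val (v p q (z - eY (rY z))) (existT mA S i')) linearB.
  have phi0 : phi y = 0.
    apply: dsum_eq0_single => -[T j]; have [e|TS] := pselect (T = S).
      subst T; rewrite phiE.
      by rewrite (iso_restr_single (V := V)) eYE subrr.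
    rewrite phiE [X in _ - X](_ : _ = 0) ?subr0; last first.
      by rewrite (iso_restr_single_ne (V := V)) // !linear0.
    exact: (@zigzag_comp0 K S T
      (dhom_comp (dcproj _ (existT mB T j)) (dhom_comp u (dcinj _ (existT mA S i))))
      (dhom_comp (dcproj _ (existT mA S i')) (dhom_comp v (dcinj _ (existT mB T j))))
      (nesym TS) p q c).
  have /eqP := phiE y; rewrite phi0 eq_sym subr_eq0 => /eqP <-.
  rewrite vu -[LHS]/(val x (existT mA S i') - val (a p q _) (existT mA S i')).
  rewrite [X in _ - X](_ : _ = 0) ?subr0.
    by rewrite -(iso_restr_single (V := V)).
  (* The correction term is a matrix entry of a null morphism between two copies of C(S), hence a
     null endomorphism. *)
  rewrite -[LHS]/(dhom_comp (dcproj _ (existT mA S i')) a p q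
    (sqhom k p q (dhom_comp a' (dcinj _ (existT mA S i)) p q c))).
  by rewrite sqhom_conj zigzag_sq0.
pose L : {linear dsum (fun _ : mA S => V S) -> dsum (fun _ : mB S => V S)} :=
  rY \o (u p q \o eX).
have [|||h hI] := @dsum_embedding K (V S) (const_mx 1) (mA S) (mB S) _ _ L;
  last by exists h.
- move=> /(congr1 (@rcoord K _)); rewrite rcoord1 ?in_points // /rcoord mul0mx mxE.
  by move/eqP; rewrite oner_eq0.
- move=> x y x0; exists (rcoord y / rcoord x).
  have cx : rcoord x != 0.
    by apply/eqP => cx; apply: x0; rewrite -[LHS]rcoordK cx scale0r.
  rewrite -[in RHS](rcoordK x) [in RHS]rcoordZ1 ?in_points //.
  by rewrite scalerA divfK // rcoordK.
- by move=> x Lx; rewrite -[LHS]rvu [rY _]Lx !linear0.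
Qed.

End Multiplicities.

(** * E_1-isomorphisms from equal zigzag multiplicities *)

Section Transfer.
Variable K : fieldType.

Lemma dcsum_ind I (D : I -> dcomplex K) p q (P : dcsum D p q -> Prop) : P 0 ->
  (forall x y, P x -> P y -> P (x + y)) -> (forall i v, P (dcinj D i p q v)) ->
  forall x, P x.
Proof. exact: dsum_ind. Qed.

Lemma dcinj_ne I (D : I -> dcomplex K) i j p q v : i <> j ->
  val (dcinj D i p q v) j = 0.
Proof. exact: dsingle_ne. Qed.

Definition dcmult (m : dshape -> Type) : dcomplex K :=
  dcsum (fun s : {T : dshape & m T} => shapeC K (projT1 s)).

Lemma transfer_exists (m m' : dshape -> Type)
    (h : forall T, is_zigzag T -> m T -> m' T) :
  exists f : dhom (dcmult m) (dcmult m'),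
    (forall T zT i p q v, f p q (dcinj _ (existT m T i) p q v) =
       dcinj _ (existT m' T (h T zT i)) p q v) /\
    (forall T i p q v, ~~ is_zigzag T -> f p q (dcinj _ (existT m T i) p q v) = 0).
Proof.
have F p q : {f : {linear dcmult m p q -> dcmult m' p q} |
    (forall T zT i v, f (dcinj _ (existT m T i) p q v) =
       dcinj _ (existT m' T (h T zT i)) p q v) /\
    (forall T i v, ~~ is_zigzag T -> f (dcinj _ (existT m T i) p q v) = 0)}.
  apply: cid.
  pose fi (s : {T : dshape & m T}) :
      {linear shapeC K (projT1 s) p q -> dcmult m' p q} :=
    match pselect (is_zigzag (projT1 s)) with
    | left zT => dcinj _ (existT m' (projT1 s) (h _ zT (projT2 s))) p q
    | right _ => \0
    end.
  have [f fE] := dsum_lift fi; exists f; split=> [T zT i v|T i v zT].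
    rewrite [LHS]fE /fi /=; case: pselect => // zT'.
    by rewrite (bool_irrelevance zT' zT).
  rewrite [LHS]fE /fi /=; case: pselect => // zT'.
  by rewrite zT' in zT.
have f1 p q x : sval (F (p + 1) q) (d1 _ p q x) = d1 _ p q (sval (F p q) x).
  move: x; apply: dcsum_ind => [|x y xE yE|[T i] v]; first by rewrite !linear0.
    by rewrite !linearD xE yE.
  rewrite -dhom_d1.
  have [zT|zT] := boolP (is_zigzag T).
    by rewrite !((svalP (F _ _)).1 T zT) dhom_d1.
  by rewrite !(svalP (F _ _)).2 // linear0.
have f2 p q x : sval (F p (q + 1)) (d2 _ p q x) = d2 _ p q (sval (F p q) x).
  move: x; apply: dcsum_ind => [|x y xE yE|[T i] v]; first by rewrite !linear0.
    by rewrite !linearD xE yE.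
  rewrite -dhom_d2.
  have [zT|zT] := boolP (is_zigzag T).
    by rewrite !((svalP (F _ _)).1 T zT) dhom_d2.
  by rewrite !(svalP (F _ _)).2 // linear0.
exists (@DHom K _ _ (fun p q => sval (F p q)) f1 f2); split=> [T zT i p q v|T i p q v].
  by have := (svalP (F p q)).1 T zT i v.
by have := (svalP (F p q)).2 T i v.
Qed.

Lemma square_d1_exact T p q (y : shapeC K T (p + 1) q) : is_square T ->
  d1 _ _ _ y = 0 -> exists x, d1 (shapeC K T) p q x = y.
Proof.
move=> sT dy; have [->|y0] := pselect (y = 0); first by exists 0; rewrite linear0.
have Ty := shapeC_mem y0.
have [Ty'|Ty'] := boolP ((p + 1 + 1, q) \in points T).
  by case: y0; apply: (bij_inj (C_d1_bij K Ty Ty')); rewrite dy linear0.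
have [|g _ gK] := @C_d1_bij K T p q _ Ty; last by exists (g y).
by move: Ty Ty'; rewrite !in_points; case: T sT {y dy y0} => //= a b _; lia.
Qed.

Lemma square_d2_exact T p q (y : shapeC K T p (q + 1)) : is_square T ->
  d2 _ _ _ y = 0 -> exists x, d2 (shapeC K T) p q x = y.
Proof.
move=> sT dy; have [->|y0] := pselect (y = 0); first by exists 0; rewrite linear0.
have Ty := shapeC_mem y0.
have [Ty'|Ty'] := boolP ((p, q + 1 + 1) \in points T).
  by case: y0; apply: (bij_inj (C_d2_bij K Ty Ty')); rewrite dy linear0.
have [|g _ gK] := @C_d2_bij K T p q _ Ty; last by exists (g y).
by move: Ty Ty'; rewrite !in_points; case: T sT {y dy y0} => //= a b _; lia.
Qed.

Definition zigzag_part m p q (x x' : dcmult m p q) : Prop :=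
  forall s, val x' s = if is_zigzag (projT1 s) then val x s else 0.

(** The rows of a square are exact, so the square components of a [d1]-cycle are boundaries. *)
Lemma zigzag_part_d1 m p q (x x' : dcmult m (p + 1) q) :
  zigzag_part x x' -> d1 _ _ _ x = 0 -> exists z, x' - x = d1 _ p q z.
Proof.
move=> xx' dx.
(* Preimages are given by linear maps in each component, so that [dsum_map] preserves finite
   support. *)
have Z (s : {T : dshape & m T}) : {c : {linear shapeC K (projT1 s) (p + 1) q ->
    shapeC K (projT1 s) p q} | d1 _ p q (c (val x s)) = val x' s - val x s}.
  apply: cid; rewrite xx'; have [zs|/negbNE sq] := boolP (is_zigzag _).
    by exists \0; rewrite linear0 subrr.
  have dxs : d1 _ _ _ (val x s) = 0.
    exact: (congr1 (fun y : dcmult m (p + 1 + 1) q => val y s) dx).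
  have [c cK] := pseudo_inverse (d1 (shapeC K (projT1 s)) p q).
  have [y yE] := square_d1_exact sq dxs; exists (\- c).
  by rewrite -yE -[LHS]/(d1 _ p q (- c _)) (linearN (d1 _ p q)) cK sub0r.
exists (dsum_map (fun s => sval (Z s)) x); apply: dsum_ext => s.
exact: (esym (svalP (Z s))).
Qed.

Lemma zigzag_part_d2 m p q (x x' : dcmult m p (q + 1)) :
  zigzag_part x x' -> d2 _ _ _ x = 0 -> exists z, x' - x = d2 _ p q z.
Proof.
move=> xx' dx.
have Z (s : {T : dshape & m T}) : {c : {linear shapeC K (projT1 s) p (q + 1) ->
    shapeC K (projT1 s) p q} | d2 _ p q (c (val x s)) = val x' s - val x s}.
  apply: cid; rewrite xx'; have [zs|/negbNE sq] := boolP (is_zigzag _).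
    by exists \0; rewrite linear0 subrr.
  have dxs : d2 _ _ _ (val x s) = 0.
    exact: (congr1 (fun y : dcmult m p (q + 1 + 1) => val y s) dx).
  have [c cK] := pseudo_inverse (d2 (shapeC K (projT1 s)) p q).
  have [y yE] := square_d2_exact sq dxs; exists (\- c).
  by rewrite -yE -[LHS]/(d2 _ p q (- c _)) (linearN (d2 _ p q)) cK sub0r.
exists (dsum_map (fun s => sval (Z s)) x); apply: dsum_ext => s.
exact: (esym (svalP (Z s))).
Qed.

Lemma transfer_can (m m' : dshape -> Type) (h : forall T, is_zigzag T -> m T -> m' T)
    (h' : forall T, is_zigzag T -> m' T -> m T)
    (f : dhom (dcmult m) (dcmult m')) (g : dhom (dcmult m') (dcmult m)) :
  (forall T zT, cancel (h T zT) (h' T zT)) ->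
  (forall T zT i p q v, f p q (dcinj _ (existT m T i) p q v) =
     dcinj _ (existT m' T (h T zT i)) p q v) ->
  (forall T i p q v, ~~ is_zigzag T -> f p q (dcinj _ (existT m T i) p q v) = 0) ->
  (forall T zT i p q v, g p q (dcinj _ (existT m' T i) p q v) =
     dcinj _ (existT m T (h' T zT i)) p q v) ->
  forall p q x, zigzag_part x (g p q (f p q x)).
Proof.
move=> hK fz fs gz p q; apply: dcsum_ind => [|x y xE yE|[T i] v] s.
- by rewrite !linear0; case: ifP.
- rewrite !linearD -[LHS]/(val (g p q (f p q x)) s + val (g p q (f p q y)) s) xE yE.
  by case: ifP => // _; rewrite addr0.
have ne := @dcinj_ne _ (fun s : {T : dshape & m T} => shapeC K (projT1 s))
  (existT m T i) s p q v.
have [zT|zT] := boolP (is_zigzag T).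
  rewrite (fz _ zT) (gz _ zT) hK; case: ifP => // zs.
  by apply: ne => e; move: zs; rewrite -e /= zT.
have -> : f p q (dcinj _ (existT m T i) p q v) = 0 by exact: fs.
rewrite linear0; case: ifP => // zs.
by apply/esym/ne => e; move: zs zT; rewrite -e /= => ->.
Qed.

(** The maps matching the zigzags and killing the squares are mutually inverse up to square
    components, which are boundaries on cycles of either differential. *)
Lemma equal_zigzags_E1 (A B : dcomplex K) (mA mB : dshape -> Type) :
  multiplicities A mA -> multiplicities B mB ->
  (forall S, is_zigzag S -> equipotent (mA S) (mB S)) ->
  exists f : dhom A B, E1_isomorphism f.
Proof.
move=> /isomorphic_inv[a [a' [aK a'K]]] /isomorphic_inv[b [b' [bK b'K]]] H.
have hh T (zT : is_zigzag T) : {h : (mA T -> mB T) * (mB T -> mA T) |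
    cancel h.1 h.2 /\ cancel h.2 h.1}.
  by apply: cid; have [h [h' hK h'K]] := H T zT; exists (h, h').
pose h T zT := (sval (hh T zT)).1; pose h' T zT := (sval (hh T zT)).2.
have hK T zT : cancel (h T zT) (h' T zT) := (svalP (hh T zT)).1.
have h'K T zT : cancel (h' T zT) (h T zT) := (svalP (hh T zT)).2.
have [f [fz fs]] := transfer_exists h; have [g [gz gs]] := transfer_exists h'.
have gf := transfer_can hK fz fs gz; have fg := transfer_can h'K gz gs fz.
pose u := dhom_comp b' (dhom_comp f a); pose v := dhom_comp a' (dhom_comp g b).
have vu p q x : v p q (u p q x) = a' p q (g p q (f p q (a p q x))).
  by rewrite -[LHS]/(a' p q (g p q (b p q (b' p q (f p q (a p q x)))))) b'K.
have uv p q x : u p q (v p q x) = b' p q (f p q (g p q (b p q x))).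
  by rewrite -[LHS]/(b' p q (f p q (a p q (a' p q (g p q (b p q x)))))) a'K.
exists u; split=> p q.
  exists (H_d1_map v p q).
    apply: subquot_map_comp_id => x; rewrite !inE => /eqP dx.
    have [|z zE] := zigzag_part_d1 (gf _ _ (a _ _ x)).
    by rewrite -dhom_d1 dx linear0.
    by exists (a' _ _ z); rewrite vu -[X in _ - X](aK _ _ x) -linearB zE dhom_d1.
  apply: subquot_map_comp_id => x; rewrite !inE => /eqP dx.
  have [|z zE] := zigzag_part_d1 (fg _ _ (b _ _ x)).
    by rewrite -dhom_d1 dx linear0.
  by exists (b' _ _ z); rewrite uv -[X in _ - X](bK _ _ x) -linearB zE dhom_d1.
exists (H_d2_map v p q).
  apply: subquot_map_comp_id => x; rewrite !inE => /eqP dx.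
  have [|z zE] := zigzag_part_d2 (gf _ _ (a _ _ x)).
    by rewrite -dhom_d2 dx linear0.
  by exists (a' _ _ z); rewrite vu -[X in _ - X](aK _ _ x) -linearB zE dhom_d2.
apply: subquot_map_comp_id => x; rewrite !inE => /eqP dx.
have [|z zE] := zigzag_part_d2 (fg _ _ (b _ _ x)).
    by rewrite -dhom_d2 dx linear0.
by exists (b' _ _ z); rewrite uv -[X in _ - X](bK _ _ x) -linearB zE dhom_d2.
Qed.

End Transfer.

Theorem proposition5 (K : fieldType) (A B : bdcomplex K) :
  (forall mA mB : dshape -> Type,
     multiplicities A mA -> multiplicities B mB ->
     ((exists f : dhom A B, E1_isomorphism f) <->
      (forall S : dshape, is_zigzag S -> equipotent (mA S) (mB S)))) /\
  (forall f : dhom A B, E1_isomorphism f ->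
     [/\ forall p q : int, bijective (H_BC_map f p q),
         forall p q : int, bijective (H_A_map f p q)
       & forall F : linear_functor K,
           kills_squares F ->
           kills_square_sums F \/ finite_dim A /\ finite_dim B ->
           bijective (lf_map F f)]).
Proof.
have bA := bdc_bounded A; have bB := bdc_bounded B; split=> [mA mB isoA isoB|f fE1].
  split=> [[f fE1] S zS|]; last exact: equal_zigzags_E1 isoA isoB.
  (* The left inverse [g] of [f] gives an injection from [mA S] to [mB S]; the left inverse [f'] of
     [g] gives one in the other direction. *)
  have [g [k [gE1 gf]]] := E1_homotopy_inverse bA bB fE1.
  have [f' [k' [_ f'g]]] := E1_homotopy_inverse bB bA gE1.
  have [h hI] := zigzag_mult_inj isoA isoB zS gf.
  have [h' h'I] := zigzag_mult_inj isoB isoA zS f'g.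
  exact: equipotent_of_inj hI h'I.
have [g [k [gE1 gf]]] := E1_homotopy_inverse bA bB fE1.
have [f' [k' [_ f'g]]] := E1_homotopy_inverse bB bA gE1.
split=> [p q|p q|F Fsq Ffin].
- apply: (bijective_of_sections (h' := H_BC_map g p q) (h'' := H_BC_map f' p q));
    [exact: H_BC_can gf _ _|exact: H_BC_can f'g _ _].
- apply: (bijective_of_sections (h' := H_A_map g p q) (h'' := H_A_map f' p q));
    [exact: H_A_can gf _ _|exact: H_A_can f'g _ _].
- exact: lf_E1_bijective.
Qed.
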